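(* Let $S\subseteq\mathbb{R}^2$ be a convex shape with two orthogonal adjacent sides $l(S), b(S)$ such that $S$ is contained in the rectangle spanned by $l(S)$ and $b(S)$, and no other side of $S$ is parallel to $l(S)$ or $b(S)$. Then for no $\alpha\in[0,1)$ does the class $\mathcal{G}(S,\alpha)$ of all intersection graphs of $\alpha$-free homothetic copies of $S$ admit product structure.
   Context: All graphs and collections are finite. A shape is a closed region of the plane; a side is a (nondegenerate, inclusion-maximal) straight line segment on its boundary; two sides are adjacent if they share an endpoint (a corner of $S$). The rectangle spanned by $l(S)$ and $b(S)$ is the rectangle having $l(S)$ and $b(S)$ as two of its sides. $\lVert S\rVert$ denotes area. $\alpha$-free: a homothetic copy of $S\subseteq\mathbb{R}^2$ is a set obtained from $S$ by positive scaling and translation. For $\alpha \in[0,1]$, a collection $\{S_v\}_{v\in V}$ of homothetic copies of $S$ is $\alpha$-free if for every $v\in V$ we have $\lVert S_v \setminus \bigcup_{u\in V\setminus\{v\}} S_u\rVert \ge \alpha\lVert S_v\rVert$. The intersection graph of the collection has vertex set $V$ and an edge $uv$ (for $u\neq v$) if and only if $S_u\cap S_v\neq\emptyset$. $\mathcal{G}(S,\alpha)$ is the class of all intersection graphs of $\alpha$-free collections of homothetic copies of $S$. Product structure: the strong product $G\boxtimes H$ has vertex set $V(G)\times V(H)$, with distinct vertices $(u,u'),(v,v')$ adjacent iff ($u=v$ or $uv\in E(G)$) and ($u'=v'$ or $u'v'\in E(H)$). A graph class $\mathcal{G}$ admits product structure if there is a constant $t$ such that every $G\in\mathcal{G}$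 is a subgraph of $H\boxtimes P$ for some path $P$ and some graph $H$ of treewidth at most $t$. *)

(* Defs.v *)
(* The plane R^2 is the product R * R, for R : realType. *)
From mathcomp Require Import all_boot all_order all_algebra.
From mathcomp Require Import all_classical all_reals all_analysis.

Set Implicit Arguments.
Unset Strict Implicit.
Unset Printing Implicit Defensive.

Import Order.TTheory GRing.Theory Num.Theory numFieldNormedType.Exports.

Local Open Scope classical_set_scope.
Local Open Scope ring_scope.

Record graph := Graph {
  vertex :> finType;
  edge : rel vertex;
  edge_sym : symmetric edge;
  edge_irr : irreflexive edge }.

Definition connected_graph (G : graph) : Prop :=
  (0 < #|G|)%N /\ forall x y : G, connect (@edge G) x y.

(* Only closed walks with at least 3 distinct vertices are cycles of the graph:
   [ucycle] also accepts [:: x; y] with x, y adjacent. *)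
Definition acyclic_graph (G : graph) : Prop :=
  forall c : seq G, (2 < size c)%N -> ~ ucycle (@edge G) c.

Definition tree (T : graph) : Prop := connected_graph T /\ acyclic_graph T.

Record tree_decomposition (G T : graph) (B : T -> {set G}) : Prop :=
  TreeDecomposition {
    td_tree : tree T;
    td_vertex : forall v : G, exists t : T, v \in B t;
    td_edge : forall u v : G, edge u v -> exists t : T, u \in B t /\ v \in B t;
    (* the nodes whose bags contain v induce a connected subgraph of T *)
    td_connected : forall (v : G) (s t : T), v \in B s -> v \in B t ->
      connect [rel x y | [&& edge x y, v \in B x & v \in B y]] s t }.

Definition treewidth_at_most (k : nat) (G : graph) : Prop :=
  exists (T : graph) (B : T -> {set G}),
    tree_decomposition B /\ forall t : T, (#|B t| <= k.+1)%N.

Section StrongProduct.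
Variables G H : graph.

Definition strong_edge : rel (G * H)%type := fun p q =>
  [&& p != q, (p.1 == q.1) || edge p.1 q.1 & (p.2 == q.2) || edge p.2 q.2].

Lemma strong_edge_sym : symmetric strong_edge.
Proof.
by move=> p q; rewrite /strong_edge eq_sym ![_ q.1 p.1]eq_sym (eq_sym p.1)
  (eq_sym p.2) edge_sym [edge p.2 _]edge_sym.
Qed.

Lemma strong_edge_irr : irreflexive strong_edge.
Proof. by move=> p; rewrite /strong_edge eqxx. Qed.

Definition strong_product : graph := Graph strong_edge_sym strong_edge_irr.
End StrongProduct.

Section Path.
Variable n : nat.

Definition path_edge : rel 'I_n.+1 := fun i j =>
  (i.+1 == j :> nat) || (j.+1 == i :> nat).

Lemma path_edge_sym : symmetric path_edge.
Proof. by move=> i j; rewrite /path_edge orbC. Qed.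

Lemma path_edge_irr : irreflexive path_edge.
Proof. by move=> i; rewrite /path_edge orbb; apply/negbTE; rewrite gtn_eqF. Qed.

Definition path_graph : graph := Graph path_edge_sym path_edge_irr.
End Path.

(* G is isomorphic to a, not necessarily induced, subgraph of H *)
Definition subgraph (G H : graph) : Prop :=
  exists f : G -> H, injective f /\ forall u v : G, edge u v -> edge (f u) (f v).

Definition admits_product_structure (C : graph -> Prop) : Prop :=
  exists t : nat, forall G : graph, C G ->
    exists (H : graph) (n : nat),
      treewidth_at_most t H /\ subgraph G (strong_product H (path_graph n)).

Section Plane.
Variable R : realType.
Local Notation plane := (R * R)%type.

(* Product Lebesgue measure; it is applied to Borel sets only. *)
Definition area (A : set plane) : \bar R :=
  ((@lebesgue_measure R) \x (@lebesgue_measure R))%E A.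

Definition boundary (A : set plane) : set plane := closure A `\` A°.

(* "region": the interior is not empty *)
Definition plane_shape (S : set plane) : Prop := closed S /\ S° !=set0.

Definition seg (p q : plane) : set plane :=
  [set p + t *: (q - p) | t in `[0, 1]%classic].

(* the segment [p, q] is a side of S *)
Definition side (S : set plane) (p q : plane) : Prop :=
  [/\ p != q, seg p q `<=` boundary S &
      forall x y : plane, seg p q `<=` seg x y -> seg x y `<=` boundary S ->
        seg x y = seg p q].

Definition orthogonal_vec (u v : plane) : Prop := u.1 * v.1 + u.2 * v.2 = 0.

Definition parallel_vec (u v : plane) : Prop := u.1 * v.2 - u.2 * v.1 = 0.

(* the rectangle with adjacent sides [c, p] and [c, q], when p - c and q - c
   are orthogonal *)
Definition spanned_rectangle (c p q : plane) : set plane :=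
  [set x | exists s t : R, [/\ 0 <= s <= 1, 0 <= t <= 1 &
    x = c + s *: (p - c) + t *: (q - c)]].

Definition homothetic_copy (S A : set plane) : Prop :=
  exists (r : R) (x : plane), 0 < r /\ A = [set x + r *: y | y in S].

Definition alpha_free (alpha : R) (V : finType) (X : V -> set plane) : Prop :=
  forall v : V,
    (alpha%:E * area (X v) <=
     area (X v `\` \bigcup_(u in [set u | u != v]) X u))%E.

Definition is_intersection_graph (G : graph) (X : G -> set plane) : Prop :=
  forall u v : G, edge u v <-> u != v /\ X u `&` X v !=set0.

Definition free_homothets_class (S : set plane) (alpha : R) (G : graph) : Prop :=
  exists X : G -> set plane,
    [/\ forall v : G, homothetic_copy S (X v), alpha_free alpha X &
        is_intersection_graph X].

End Plane.

(* Main.v *)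
(* Choose coordinates in which c is the origin and the sides l(S), b(S) are the
   unit segments on the axes; S is then a down-closed convex part of the unit
   square that meets the right edge s = 1 only in the tip (1, 0), because an edge
   of S on that line would be a side parallel to l(S).

   Put a row of unit copies ("hubs") side by side, the right tip of each at the
   corner of the next one. Just above this contact point, between the left side
   of a hub and the curved side of its left neighbour, there is a wedge of free
   space, and the space below the hubs is free as well. A small "foot" copy
   reaches the hub from below with its top tip and meets there a string of tiny
   copies ("wire") that comes down through the wedge and pokes the left side of
   the hub: the wire and the foot form a path that crosses the row of hubs. At
   exponentially decreasing scales, K such crossings fit at one contact point, and
   all overlaps are negligible relative to both copies involved.

   Stacking n rows of a hubs, where the crossings of consecutive rows are joined,
   gives n disjoint chains crossed by a K disjoint strands. One huge copy touches
   all the rows at their right ends, so every vertex is at distance at most a + O(1)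
   from it, where O(1) depends on K but not on a. In a product of a graph
   of treewidth t and a path, the vertices of a bag lying in the O(a) relevant
   layers of the path hit all the crosses (chain union strand) of this grid; hence
   min(n, a K) <= (t + 1) (2 a + O(1)), which fails for K = 3 (t + 1), n = a K
   and a large. *)
Require Import Defs.
From mathcomp Require Import all_boot all_order all_algebra.
From mathcomp Require Import all_classical all_reals all_analysis.
From mathcomp Require Import measurable_realfun zify ring lra.
Set Implicit Arguments.
Unset Strict Implicit.
Unset Printing Implicit Defensive.
Import Order.TTheory GRing.Theory Num.Theory numFieldNormedType.Exports.

(** * Connected vertex sets and the Helly property of subtrees *)

Section ConnectedSets.

Variable T : finType.
Implicit Types (e : rel T) (A B C : {set T}).

Definition rel_in e A : rel T := [rel x y | [&& e x y, x \in A & y \in A]].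

Definition connected_in e A : Prop :=
  forall x y, x \in A -> y \in A -> connect (rel_in e A) x y.

Lemma rel_in_sym e A : symmetric e -> symmetric (rel_in e A).
Proof. by move=> se x y; rewrite /rel_in /= se andbCA andbC andbA. Qed.

Lemma rel_in_sub e A B x y : A \subset B ->
  connect (rel_in e A) x y -> connect (rel_in e B) x y.
Proof.
move=> AB; apply: fingraph.connect_sub => u v /and3P[uv uA vA]; apply: connect1.
by rewrite /rel_in /= uv !(fintype.subsetP AB).
Qed.

Lemma path_rel_in e A x p : x \in A ->
  path (rel_in e A) x p = path e x p && all [in A] p.
Proof.
elim: p x => //= y p IH x xA; rewrite /rel_in /= xA /=.
case yA: (y \in A) => /=; last by rewrite !andbF.
by rewrite IH // andbT andbA.
Qed.

Lemma uniq_path_in e A x y : x \in A -> connect (rel_in e A) x y ->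
  exists p, [/\ path e x p, uniq (x :: p), all [in A] p & last x p = y].
Proof.
move=> xA /connectP[p pp ->]; case/shortenP: pp => q pq uq _.
by move: pq; rewrite path_rel_in // => /andP[? ?]; exists q.
Qed.

Lemma connect_rel_in e A x p : x \in A -> path e x p -> all [in A] p ->
  connect (rel_in e A) x (last x p).
Proof.
by move=> xA pp Ap; apply/connectP; exists p => //; rewrite path_rel_in // pp.
Qed.

Lemma connected_inU e A B : symmetric e ->
  connected_in e A -> connected_in e B ->
  (exists x y, [/\ x \in A, y \in B & x = y \/ e x y]) ->
  connected_in e (A :|: B).
Proof.
move=> se cA cB [x [y [xA yB xy]]].
have cxy : connect (rel_in e (A :|: B)) x y.
  case: xy => [->|xy]; first exact: connect0.
  by apply: connect1; rewrite /rel_in /= xy !inE xA yB orbT.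
have sAB := finset.subsetUl A B; have sBA := finset.subsetUr A B.
have csym := sym_connect_sym (rel_in_sym (A :|: B) se).
have cx u : u \in A :|: B -> connect (rel_in e (A :|: B)) x u.
  rewrite inE => /orP[uA|uB]; first exact: (rel_in_sub sAB (cA _ _ _ _)).
  exact: connect_trans cxy (rel_in_sub sBA (cB _ _ _ _)).
by move=> u v uU vU; apply: (@connect_trans _ _ x); [rewrite csym|]; exact: cx.
Qed.
End ConnectedSets.

Section Helly.

Variable T : graph.
Hypothesis acT : acyclic_graph T.
Notation e := (@edge T).
Notation conn := (connected_in e).
Implicit Types (A B C : {set T}).

Lemma acyclic_path x p : 1 < size p -> path e x p -> uniq (x :: p) ->
  ~~ e (last x p) x.
Proof.
move=> sp pp up; apply/negP => ex; apply: (acT (c := x :: p)); first by [].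
by rewrite /ucycle up andbT /= rcons_path pp ex.
Qed.

(** Induction along both paths. If the first steps [a] and [b] differed, the two tails would connect
    [a] and [b] inside the complement of [x], and a simple path there closes up through [x] to a
    cycle. *)
Lemma uniq_path_unique x p q : path e x p -> uniq (x :: p) ->
  path e x q -> uniq (x :: q) -> last x p = last x q -> p = q.
Proof.
elim: p x q => [|a p IH] x [|b q] //=.
- by move=> _ _ _ /andP[/negP xq _] eq; case: xq; rewrite [X in X \in _]eq mem_last.
- by move=> _ /andP[/negP xp _] _ _ eq; case: xp; rewrite -[X in X \in _]eq mem_last.
move=> /andP[xa pa] /andP[xp up] /andP[xb pb] /andP[xq uq] eq.
have [ab|ab] := eqVneq a b.
  by subst b; congr (_ :: _); apply: (IH a).
exfalso.
pose A := [set~ x].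
have in_A z s : x \notin z :: s -> z \in A /\ all [in A] s.
  move=> xs; split; first by rewrite !inE eq_sym; case/norP: xs.
  by apply/allP => u us; rewrite !inE; apply: contraNneq xs => <-; rewrite inE us orbT.
have [aA pA] := in_A _ _ xp; have [bA qA] := in_A _ _ xq.
have cab : connect (rel_in e A) a b.
  apply: (connect_trans (connect_rel_in aA pa pA)).
  rewrite eq (sym_connect_sym (rel_in_sym _ (@edge_sym T))).
  exact: connect_rel_in.
have [w [pw uw wA lw]] := uniq_path_in aA cab.
have := @acyclic_path x (a :: w); rewrite /= xa pw lw edge_sym xb.
case: (w) lw uw wA => [|c w'] lw uw wA; first by move: ab; rewrite -lw eqxx.
move=> /(_ isT isT) /=; rewrite /= in uw; rewrite uw andbT.
suff -> : x \notin [:: a, c & w'] by move=> /(_ isT).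
rewrite inE negb_or; move: aA; rewrite !inE eq_sym => ->/=.
by apply/negP => xw; have := allP wA _ xw; rewrite !inE eqxx.
Qed.

(** The simple paths found inside [A] and inside [B] are the same path of the forest, which
    therefore lies in the intersection. *)
Lemma connected_inI A B : conn A -> conn B -> conn (A :&: B).
Proof.
move=> cA cB x y; rewrite !inE => /andP[xA xB] /andP[yA yB].
have [p [pp up pA lp]] := uniq_path_in xA (cA _ _ xA yA).
have [q [pq uq qB lq]] := uniq_path_in xB (cB _ _ xB yB).
have pq_eq : p = q by apply: (@uniq_path_unique x) => //; rewrite lp.
subst q; rewrite -lp; apply: connect_rel_in => //; first by rewrite inE xA.
by apply/allP => z zp; rewrite !inE (allP pA) // (allP qB).
Qed.

(** By uniqueness, the path from [a] to [b] inside [C] is also the path inside the connected set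
    [B :|: A]. It starts in [B] and ends in [A]; the last vertex before it first leaves [B], or else
    its end, lies in all three sets. *)
Lemma helly3 A B C : conn A -> conn B -> conn C ->
  A :&: B != finset.set0 -> A :&: C != finset.set0 -> B :&: C != finset.set0 ->
  A :&: B :&: C != finset.set0.
Proof.
move=> cA cB cC /set0Pn[c /setIP[c_A c_B]] /set0Pn[b /setIP[bA bC]].
move=> /set0Pn[a /setIP[aB aC]].
have [p [pp up pC lp]] := uniq_path_in aC (cC _ _ aC bC).
have cAB : conn (B :|: A).
  by apply: connected_inU => //; [exact: edge_sym|exists c, c; split => //; left].
have [q [pq uq qAB lq]] : exists q, [/\ path e a q, uniq (a :: q),
    all [in B :|: A] q & last a q = b].
  by apply: uniq_path_in; rewrite ?inE ?aB //; apply: cAB; rewrite inE ?aB ?bA ?orbT.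
have eq : p = q by apply: (@uniq_path_unique a) => //; rewrite lp.
subst q; apply/set0Pn.
elim: p a aB aC pp up pC lp qAB {pq uq lq} => [|v p IH] a aB aC /=.
  by move=> _ _ _ ab _; exists a; rewrite !inE aB aC ab bA.
move=> /andP[av pv] /andP[anp up] /andP[vC pC] lp /andP[vAB pAB].
have [vB|vnB] := boolP (v \in B); first exact: (IH v).
have vA : v \in A by move: vAB; rewrite inE (negbTE vnB).
(* The edge from [a] to [v] leaves [B]. The path from [a] to [c] in [B], prolonged by [v], is
   simple, hence equal to the path from [v] to [c] in [A], so [a] is in [A]. *)
have [r [pr ur rB lr]] := uniq_path_in aB (cB _ _ aB c_B).
have [s [ps us sA ls]] := uniq_path_in vA (cA _ _ vA c_A).
have vr : v \notin a :: r.
  by apply: contra vnB; rewrite inE => /orP[/eqP->//|/(allP rB)].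
have sE : s = a :: r.
  apply: (@uniq_path_unique v) => //; rewrite ?ls ?lr //=.
    by rewrite edge_sym av.
  by rewrite -/(uniq (a :: r)) ur andbT.
by exists a; rewrite !inE aB aC !andbT; apply: (allP sA); rewrite sE mem_head.
Qed.

(** Induction on [s], with [A] replaced by its intersection with the head; [helly3] shows that this
    smaller set still meets the remaining ones. *)
Lemma helly (A : {set T}) (s : seq {set T}) :
  conn A -> A != finset.set0 -> (forall B, B \in s -> conn B) ->
  (forall B, B \in s -> A :&: B != finset.set0) ->
  (forall B C, B \in s -> C \in s -> B :&: C != finset.set0) ->
  exists2 x, x \in A & forall B, B \in s -> x \in B.
Proof.
elim: s A => [|B s IH] A cA A0 cs iA is_; first by case/set0Pn: A0 => x; exists x.
have Bs : B \in B :: s := mem_head _ _.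
have sub C : C \in s -> C \in B :: s by move=> Cs; rewrite inE Cs orbT.
have [|||||x] := IH (A :&: B).
- by apply: connected_inI => //; exact: cs.
- exact: iA.
- by move=> C Cs; exact/cs/sub.
- move=> C Cs; apply: helly3 => //; [exact: cs|exact/cs/sub|exact: iA|
    exact/iA/sub|by apply: is_ => //; exact: sub].
- by move=> C D Cs Ds; apply: is_; exact: sub.
rewrite inE => /andP[xA xB] H; exists x => // C; rewrite inE => /orP[/eqP->//|].
exact: H.
Qed.
End Helly.

Lemma connected_in_root (T : finType) (e : rel T) (A : {set T}) r : symmetric e ->
  (forall x, x \in A -> connect (rel_in e A) r x) -> connected_in e A.
Proof.
move=> se h x y xA yA; apply: (@connect_trans _ _ r); last exact: h.
by rewrite (sym_connect_sym (rel_in_sym _ se)); exact: h.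
Qed.

(** * Walks of bounded length *)

Section Reach.
Variable G : graph.

Definition reach (n : nat) (x y : G) : Prop :=
  exists p, [/\ path (@edge G) x p, last x p = y & (size p <= n)%N].

Lemma reach_step n x y z : reach n x y -> y = z \/ edge y z -> reach n.+1 x z.
Proof.
move=> [p [pp lp sp]] [<-|yz]; first by exists p; split => //; exact: leqW.
by exists (rcons p z); rewrite rcons_path pp lp yz last_rcons size_rcons.
Qed.

Lemma reach_leq m n x y : (m <= n)%N -> reach m x y -> reach n x y.
Proof. by move=> mn [p [pp lp sp]]; exists p; split => //; exact: leq_trans mn. Qed.

(** The map [f] may collapse edges, which only shortens the walk; a simple path in [T] has fewer
    than #|T| steps. *)
Lemma reach_path (T : finType) (e : rel T) (f : T -> G) n x a b :
  (forall u v, e u v -> f u = f v \/ edge (f u) (f v)) ->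
  reach n x (f a) -> connect e a b -> reach (n + #|T|) x (f b).
Proof.
move=> fe ra /connectP[p pp ->]; case/shortenP: pp => s ps us _.
have ss : (size s <= #|T|)%N.
  by apply: ltnW; have := max_card (mem (a :: s)); rewrite (card_uniqP us).
apply: (@reach_leq (n + size s)); first by rewrite leq_add2l.
elim: s n a ra ps {us ss p} => [|u s IH] n a ra /=; first by rewrite addn0.
move=> /andP[/fe au ps]; rewrite addnS -addSn; apply: IH => //.
exact: reach_step ra au.
Qed.
End Reach.

(** * Grids of small radius in products with a path *)

Section ProductBramble.
Variables (G H T : graph) (B : T -> {set H}) (g : G -> H).
Hypothesis dB : tree_decomposition B.
Hypothesis g_edge : forall u v : G, edge u v -> g u = g v \/ edge (g u) (g v).

Definition bag_nodes (A : {set G}) : {set T} :=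
  [set x | [exists v, (v \in A) && (g v \in B x)]].

Lemma bag_nodesP (A : {set G}) x :
  reflect (exists2 v, v \in A & g v \in B x) (x \in bag_nodes A).
Proof.
rewrite inE; apply: (iffP existsP) => [[v /andP[]]|[v vA vx]]; first by exists v.
by exists v; rewrite vA.
Qed.

Lemma common_bag (u v : G) : u = v \/ edge u v ->
  exists x, g u \in B x /\ g v \in B x.
Proof.
have eqb w w' : g w = g w' -> exists x, g w \in B x /\ g w' \in B x.
  by move=> ->; have [x] := td_vertex dB (g w'); exists x.
move=> [->|/g_edge[|]]; [exact: eqb|exact: eqb|exact: (td_edge dB)].
Qed.

(** Along a path in [A], the nodes of each single vertex form a connected set, and consecutive
    vertices share a node. *)
Lemma bag_nodes_connected (A : {set G}) :
  connected_in (@edge G) A -> connected_in (@edge T) (bag_nodes A).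
Proof.
move=> cA s t /bag_nodesP[v vA vs] /bag_nodesP[w wA wt].
have [p [pp _ pA lp]] := uniq_path_in vA (cA _ _ vA wA).
have step u x y : u \in A -> g u \in B x -> g u \in B y ->
    connect (rel_in (@edge T) (bag_nodes A)) x y.
  move=> uA ux uy; apply: fingraph.connect_sub (td_connected dB ux uy) => a b.
  move=> /and3P[ab ua ub]; apply: connect1; rewrite /rel_in /= ab /=.
  by apply/andP; split; apply/bag_nodesP; exists u.
elim: p v s vA vs pp pA lp => [|u p IH] v s vA vs /=.
  by move=> _ _ vw; subst w; exact: (step v).
move=> /andP[vu pp] /andP[uA pA] lp.
have [x [vx ux]] := common_bag (or_intror vu).
exact: (connect_trans (step v _ _ vA vs vx) (IH u x uA ux pp pA lp)).
Qed.
End ProductBramble.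

Lemma path_layer (G H : graph) n (f : G -> strong_product H (path_graph n))
  (z : G) p : (forall u v, edge u v -> edge (f u) (f v)) -> path (@edge G) z p ->
  ((f (last z p)).2 <= (f z).2 + size p)%N && ((f z).2 <= (f (last z p)).2 + size p)%N.
Proof.
move=> fe; elim: p z => [|y p IH] z /=; first by rewrite !addn0 leqnn.
move=> /andP[zy /IH/andP[]].
have /and3P[_ _] := fe _ _ zy.
rewrite /edge/= /path_edge -val_eqE /=.
case: (f z).2 (f y).2 (f (last y p)).2 => a _ [b _] [c _] /=.
lia.
Qed.

Lemma card_le_hit (G I : finType) (C : I -> {set G}) (U : {set G}) :
  (forall i i' v, v \in C i -> v \in C i' -> i = i') ->
  (#|U| < #|I|)%N -> exists i, C i :&: U = finset.set0.
Proof.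
move=> dC; apply: contraPP => /forallNP hC; apply/negP; rewrite -leqNgt.
have hit i : exists v, v \in C i :&: U by apply/set0Pn/eqP/hC.
have [h hh] := boolp.choice hit.
rewrite -cardsT; apply: leq_trans (_ : #|[set h i | i in [set: I]]| <= _)%N.
  rewrite card_imset // => i i' ii'; apply: (dC _ _ (h i)).
    by have := hh i; rewrite inE => /andP[].
  by rewrite ii'; have := hh i'; rewrite inE => /andP[].
apply: subset_leq_card; apply/fintype.subsetP => _ /imsetP[i _ ->].
by have := hh i; rewrite inE => /andP[].
Qed.

(** The crosses [K (i, j)] pairwise touch, because [C i] touches every [D l], so by the Helly
    property some bag [B x] meets the projection of every cross. The vertices over this bag within
    distance [r] of [z] occupy at most 2 r + 1 layers. If both families outnumber them, some [C i]
    and some [D j] are missed, and so is their cross. *)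
Lemma product_bramble (G H : graph) (n t r : nat) (I J : finType)
    (C : I -> {set G}) (D : J -> {set G}) (z : G) :
  treewidth_at_most t H -> subgraph G (strong_product H (path_graph n)) ->
  (forall i, connected_in (@edge G) (C i)) ->
  (forall j, connected_in (@edge G) (D j)) ->
  (forall i i' v, v \in C i -> v \in C i' -> i = i') ->
  (forall j j' v, v \in D j -> v \in D j' -> j = j') ->
  (forall i j, exists u v, [/\ u \in C i, v \in D j & u = v \/ edge u v]) ->
  (forall v, (exists i, v \in C i) \/ (exists j, v \in D j) ->
    exists p, [/\ path (@edge G) z p, last z p = v & size p <= r]%N) ->
  (#|I| <= t.+1 * r.*2.+1)%N \/ (#|J| <= t.+1 * r.*2.+1)%N.
Proof.
move=> [T [B [dB szB]]] [f [f_inj f_edge]] cC cD dC dD tCD rad.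
have [I0|I0] := posnP #|I|; first by left; rewrite I0.
have [J0|J0] := posnP #|J|; first by right; rewrite J0.
have [i0 _] := card_gt0P I0; have [j0 _] := card_gt0P J0.
pose g v := (f v).1.
have g_edge u v : edge u v -> g u = g v \/ edge (g u) (g v).
  by move=> /f_edge/and3P[_ /orP[/eqP|]]; [left|right].
have acT : acyclic_graph T by case: (td_tree dB).
pose K ij := C ij.1 :|: D ij.2; pose N ij := bag_nodes B g (K ij).
have cN ij : connected_in (@edge T) (N ij).
  apply: (bag_nodes_connected dB g_edge); apply: connected_inU => //.
  exact: edge_sym.
have meetN ij kl : N ij :&: N kl != finset.set0.
  have [u [v [uC vD uv]]] := tCD ij.1 kl.2.
  have [x [ux vx]] := common_bag dB g_edge uv.
  apply/set0Pn; exists x; rewrite inE; apply/andP; split; apply/bag_nodesP.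
    by exists u => //; rewrite inE uC.
  by exists v => //; rewrite inE vD orbT.
have [||||x _ xN] := @helly T acT (N (i0, j0)) [seq N ij | ij : I * J] (cN _).
- by have := meetN (i0, j0) (i0, j0); rewrite finset.setIid.
- by move=> _ /fintype.imageP[ij _ ->].
- by move=> _ /fintype.imageP[ij _ ->].
- by move=> _ _ /fintype.imageP[ij _ ->] /fintype.imageP[kl _ ->].
pose lay v : nat := (f v).2.
pose near v := (lay v <= lay z + r)%N && (lay z <= lay v + r)%N.
pose U := [set v : G | (g v \in B x) && near v].
have cardU : (#|U| <= t.+1 * r.*2.+1)%N.
  (* The shift by [r] makes the layer difference, which lies between - r and r, an ordinal below 2 r
     + 1. *)
  pose h v : H * 'I_r.*2.+1 := (g v, inord (lay v + r - lay z)).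
  have h_inj : {in U &, injective h}.
    move=> u v; rewrite !inE => /andP[_ nu] /andP[_ nv] [guv] /(congr1 val) /=.
    rewrite !inordK; [|move: nv; rewrite /near; lia|move: nu; rewrite /near; lia].
    move=> luv; apply: f_inj; rewrite [f u]surjective_pairing [f v]surjective_pairing.
    congr pair => //; apply: val_inj.
    by move: nu nv luv; rewrite /near /lay /=; lia.
  rewrite -(card_in_imset h_inj) -[X in (_ <= _ * X)%N]card_ord -cardsT.
  apply: leq_trans (_ : #|B x| * #|[set: 'I_r.*2.+1]| <= _)%N; last first.
    by rewrite leq_mul2r szB orbT.
  rewrite -cardsX; apply: subset_leq_card; apply/fintype.subsetP => _ /imsetP[v vU ->].
  by move: vU; rewrite !inE andbT => /andP[].
apply/orP; rewrite leqNgt -[X in _ || X]negbK -negb_and -ltnNge; apply/negP.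
move=> /andP[UI UJ].
have [i Ci] := card_le_hit dC (leq_ltn_trans cardU UI).
have [j Dj] := card_le_hit dD (leq_ltn_trans cardU UJ).
have /bag_nodesP[v vK vx] : x \in N (i, j) by apply/xN/fintype.imageP; exists (i, j).
have vU : v \in U.
  rewrite inE vx /near /lay /=; have [|p [pp <- pr]] := rad v.
    by move: vK; rewrite inE => /orP[?|?]; [left; exists i|right; exists j].
  have /andP[h1 h2] := path_layer f_edge pp.
  by apply/andP; split; [apply: leq_trans h1 _|apply: leq_trans h2 _];
    rewrite leq_add2l.
have vUP (E : {set G}) : v \in E -> E :&: U = finset.set0 -> False.
  by move=> vE EU; have : v \in E :&: U; [rewrite inE vE|rewrite EU inE].
by move: vK; rewrite inE /= => /orP[/vUP|/vUP]; apply.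
Qed.

Local Open Scope classical_set_scope.
Local Open Scope ring_scope.

(** * Area of homothetic copies *)

Section Area.
Variable R : realType.
Local Notation plane := (R * R)%type.
Local Notation mplane := (measurableTypeR R * measurableTypeR R)%type.
Local Notation mu := (@lebesgue_measure R).

(** An open set is the countable union of the rational boxes that it contains; [F] is empty for the
    other boxes. *)
Lemma open_plane_measurable (U : set plane) :
  open U -> measurable (U : set mplane).
Proof.
move=> oU; pose box (a b c d : rat) : set mplane :=
  `]ratr a, ratr b[%classic `*` `]ratr c, ratr d[%classic.
pose F a b c d : set mplane :=
  if pselect (box a b c d `<=` U) then box a b c d else set0.
suff -> : (U : set mplane) = \bigcup_a \bigcup_b \bigcup_c \bigcup_d F a b c d.
  do 4 (apply: bigcupT_measurable_rat => ?); rewrite /F; case: pselect => h.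
    by apply: measurableX; exact: measurable_itv.
  exact: measurable0.
apply/seteqP; split => [[x y] Uxy|z]; last first.
  by move=> [a _ [b _ [c _ [d _]]]]; rewrite /F; case: pselect => // H; exact: H.
have /nbhs_ballP[e /= e0 eU] := open_nbhs_nbhs (conj oU Uxy).
have [a] := @rat_in_itvoo R (x - e) x ltac:(lra).
have [b] := @rat_in_itvoo R x (x + e) ltac:(lra).
have [c] := @rat_in_itvoo R (y - e) y ltac:(lra).
have [d] := @rat_in_itvoo R y (y + e) ltac:(lra).
rewrite !in_itv /= => /andP[d1 d2] /andP[c1 c2] /andP[b1 b2] /andP[a1 a2].
exists a => //; exists b => //; exists c => //; exists d => //.
rewrite /F; case: pselect => [h|[]]; first by split; rewrite /= in_itv /=; lra.
move=> [u v] [/=]; rewrite !in_itv /= => /andP[u1 u2] /andP[v1 v2]; apply: eU.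
by split; rewrite /= /ball /= ltr_norml; apply/andP; split; lra.
Qed.

Lemma closed_plane_measurable (A : set plane) :
  closed A -> measurable (A : set mplane).
Proof.
by move=> cA; rewrite -[A]setCK; apply: measurableC; apply: open_plane_measurable;
  exact: closed_openC.
Qed.

Definition contract (r a : R) : measurableTypeR R -> measurableTypeR R :=
  fun u => r^-1 * (u - a).

Lemma measurable_contract r a : measurable_fun setT (contract r a).
Proof.
apply: continuous_measurable_fun => u; rewrite /contract.
by apply: cvgM; [exact: cvg_cst|apply: cvgB; [exact: cvg_id|exact: cvg_cst]].
Qed.

(** The pushforward of Lebesgue measure under [contract], divided by [r], agrees with Lebesgue
    measure on half-open intervals, so uniqueness applies. *)
Lemma lebesgue_measure_contract (r a : R) (A : set (measurableTypeR R)) :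
  0 < r -> measurable A -> (mu (contract r a @^-1` A) = r%:E * mu A)%E.
Proof.
move=> r0 mA; have r1 : 0 <= r^-1 by rewrite invr_ge0 ltW.
pose m' : {measure set _ -> \bar R} :=
  mscale (NngNum r1) [the measure _ _ of pushforward mu (contract r a)].
suff -> : (mu A = r^-1%:E * mu (contract r a @^-1` A))%E.
  by rewrite muleA -EFinM divff ?mul1e ?gt_eqF.
have -> : (r^-1%:E * mu (contract r a @^-1` A))%E = m' (measurable_contract r a) A by [].
apply: lebesgue_measure_unique mA => _ [[b c]] _ <-.
rewrite [RHS](_ : _ = r^-1%:E * mu (contract r a @^-1` `]b, c]%classic))%E //.
have -> : contract r a @^-1` `]b, c]%classic = `]a + r * b, a + r * c]%classic.
  apply/seteqP; split => u /=; rewrite !in_itv /= /contract.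
    by rewrite ltr_pdivlMl // ler_pdivrMl // => /andP[? ?]; lra.
  by rewrite ltr_pdivlMl // ler_pdivrMl // => /andP[? ?]; apply/andP; split; lra.
rewrite !lebesgue_measure_itv /= !lte_fin ltrD2l ltr_pM2l //.
case: ifP => _; last by rewrite mule0.
rewrite -!EFinD -EFinM; congr EFin; field; lra.
Qed.

Definition contract2 (r : R) (x : plane) : mplane -> mplane :=
  fun y => (contract r x.1 y.1, contract r x.2 y.2).

Lemma measurable_contract2 r x : measurable_fun setT (contract2 r x).
Proof.
apply: measurable_fun_pair.
  by apply: measurableT_comp; [exact: measurable_contract|exact: measurable_fst].
by apply: measurableT_comp; [exact: measurable_contract|exact: measurable_snd].
Qed.

Lemma homothety_preimage (r : R) (x : plane) (A : set plane) : 0 < r ->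
  [set x + r *: y | y in A] = contract2 r x @^-1` A.
Proof.
move=> r0; apply/seteqP; split => [_ [[u v] Auv <-]|[u v] Auv].
  rewrite /contract2 /contract /= !(addrC x.1, addrC x.2) !addrK.
  by rewrite !mulKf ?gt_eqF.
exists (contract2 r x (u, v)) => //.
rewrite /contract2 /contract /= [RHS]surjective_pairing.
by congr pair => /=; rewrite /GRing.scale /= mulVKf ?gt_eqF // addrC subrK.
Qed.

Lemma measurable_homothety (r : R) (x : plane) (A : set plane) : 0 < r ->
  measurable (A : set mplane) ->
  measurable ([set x + r *: y | y in A] : set mplane).
Proof.
move=> r0 mA; rewrite homothety_preimage // -[X in measurable X]setTI.
exact: measurable_contract2.
Qed.

(** Uniqueness of the product measure reduces the claim to measurable rectangles, where each factor
    scales by [r]. *)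
Lemma area_homothety (r : R) (x : plane) (A : set plane) : 0 < r ->
  measurable (A : set mplane) ->
  area [set x + r *: y | y in A] = ((r ^+ 2)%:E * area A)%E.
Proof.
move=> r0 mA; have r1 : 0 <= r ^- 2 by rewrite invr_ge0 exprn_ge0 // ltW.
pose m' : {measure set mplane -> \bar R} :=
  mscale (NngNum r1) [the measure _ _ of pushforward (mu \x mu)%E (contract2 r x)].
rewrite homothety_preimage //.
suff -> : (area A = (r ^- 2)%R%:E * area (contract2 r x @^-1` A))%E.
  by rewrite muleA -EFinM divff ?mul1e ?expf_neq0 ?gt_eqF.
have -> : ((r ^- 2)%R%:E * area (contract2 r x @^-1` A))%E =
  m' (measurable_contract2 r x) A by [].
apply: product_measure_unique mA => B C mB mC.
rewrite [LHS](_ : _ = (r ^- 2)%R%:E * (mu \x mu) (contract2 r x @^-1` (B `*` C)))%E //.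
have -> : contract2 r x @^-1` (B `*` C) =
  (contract r x.1 @^-1` B) `*` (contract r x.2 @^-1` C) by [].
rewrite product_measure1E //; last 2 first.
- by rewrite -[X in measurable X]setTI; exact: measurable_contract.
- by rewrite -[X in measurable X]setTI; exact: measurable_contract.
have h1 := lebesgue_measure_contract x.1 r0 mB.
have h2 := lebesgue_measure_contract x.2 r0 mC.
transitivity ((r ^- 2)%R%:E * (r%:E * mu B * (r%:E * mu C)))%E.
  by rewrite -h1 -h2.
have e : ((r ^- 2)%R%:E * (r%:E * r%:E) = 1)%E.
  by rewrite -!EFinM -expr2 mulVf // expf_neq0 // gt_eqF.
rewrite muleACA [LHS]muleA; transitivity (1 * (mu B * mu C))%E; last by rewrite mul1e.
by congr (_ * _)%E; exact: e.
Qed.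
End Area.

(** * Normal form of the shape *)

Section Frame.
Variable R : realType.
Local Notation plane := (R * R)%type.

(* S in the coordinates (s, t) of the point c + s (q - c) + t (p - c). The last
   field says that S is thin near the right tip (1, 0). *)
Record corner_shape (Q : R -> R -> Prop) : Prop := CornerShape {
  corner_box : forall s t, Q s t -> (0 <= s <= 1) /\ (0 <= t <= 1);
  corner_down : forall s t s' t', Q s t -> 0 <= s' <= s -> 0 <= t' <= t -> Q s' t';
  corner_right : Q 1 0;
  corner_top : Q 0 1;
  corner_half : Q 2^-1 2^-1;
  corner_shrink : forall s t k, Q s t -> 0 <= k <= 1 ->
    Q (3^-1 + k * (s - 3^-1)) (3^-1 + k * (t - 3^-1));
  corner_thin : forall t, 0 < t ->
    exists2 d, 0 < d & forall s, 1 - d < s -> ~ Q s t }.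

Definition frame (c p q z : plane) : plane :=
  c + z.1 *: (q - c) + z.2 *: (p - c).

Lemma frame1 c p q z :
  (frame c p q z).1 = c.1 + z.1 * (q.1 - c.1) + z.2 * (p.1 - c.1).
Proof. by []. Qed.

Lemma frame2 c p q z :
  (frame c p q z).2 = c.2 + z.1 * (q.2 - c.2) + z.2 * (p.2 - c.2).
Proof. by []. Qed.

Lemma plane_eq (x y : plane) : x.1 = y.1 -> x.2 = y.2 -> x = y.
Proof. by case: x y => [x1 x2] [y1 y2] /= -> ->. Qed.

Lemma frame_affine c p q (z w : plane) (k : R) :
  frame c p q (z + k *: (w - z)) = frame c p q z + k *: (frame c p q w - frame c p q z).
Proof.
by apply: plane_eq; rewrite ?frame1 ?frame2 /= /GRing.scale /= ?frame1 ?frame2; ring.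
Qed.

(** Inner products of the difference with [q - c] and [p - c] isolate one coordinate each. *)
Lemma orthogonal_frame_inj (c p q : plane) : c != p -> c != q ->
  orthogonal_vec (p - c) (q - c) -> injective (frame c p q).
Proof.
move=> cp cq; rewrite /orthogonal_vec /= => o [z1 z2] [w1 w2] zw.
have := congr1 fst zw; have := congr1 snd zw; rewrite !frame1 !frame2 /= => e2 e1.
have pos (a : plane) : c != a -> 0 < (a.1 - c.1) ^+ 2 + (a.2 - c.2) ^+ 2.
  move=> ca; rewrite lt_neqAle addr_ge0 ?sqr_ge0 // andbT eq_sym.
  rewrite paddr_eq0 ?sqr_ge0 // !sqrf_eq0 !subr_eq0.
  by apply: contra ca => /andP[/eqP a1 /eqP a2]; apply/eqP/esym/plane_eq.
have hp := pos _ cp; have hq := pos _ cq.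
have d1 : (z1 - w1) * (q.1 - c.1) + (z2 - w2) * (p.1 - c.1) = 0.
  by move: e1; lra.
have d2 : (z1 - w1) * (q.2 - c.2) + (z2 - w2) * (p.2 - c.2) = 0.
  by move: e2; lra.
congr pair; apply/eqP; rewrite -subr_eq0.
  have /eqP : (z1 - w1) * ((q.1 - c.1) ^+ 2 + (q.2 - c.2) ^+ 2) = 0.
    transitivity ((q.1 - c.1) * ((z1 - w1) * (q.1 - c.1) + (z2 - w2) * (p.1 - c.1))
      + (q.2 - c.2) * ((z1 - w1) * (q.2 - c.2) + (z2 - w2) * (p.2 - c.2))
      - (z2 - w2) * ((p.1 - c.1) * (q.1 - c.1) + (p.2 - c.2) * (q.2 - c.2))).
      by ring.
    by rewrite d1 d2 o; ring.
  by rewrite mulf_eq0 (gt_eqF hq) orbF.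
have /eqP : (z2 - w2) * ((p.1 - c.1) ^+ 2 + (p.2 - c.2) ^+ 2) = 0.
  transitivity ((p.1 - c.1) * ((z1 - w1) * (q.1 - c.1) + (z2 - w2) * (p.1 - c.1))
    + (p.2 - c.2) * ((z1 - w1) * (q.2 - c.2) + (z2 - w2) * (p.2 - c.2))
    - (z1 - w1) * ((p.1 - c.1) * (q.1 - c.1) + (p.2 - c.2) * (q.2 - c.2))).
    by ring.
  by rewrite d1 d2 o; ring.
by rewrite mulf_eq0 (gt_eqF hp) orbF.
Qed.

(** The constant [m] exceeds the Lipschitz constant of both coordinates of the frame. *)
Lemma frame_near c p q (e : R) : 0 < e -> exists2 d, 0 < d &
  forall z w : plane, `|w.1 - z.1| < d -> `|w.2 - z.2| < d ->
    ball (frame c p q z) e (frame c p q w).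
Proof.
move=> e0; set m := 1 + (`|q.1 - c.1| + `|q.2 - c.2| + `|p.1 - c.1| + `|p.2 - c.2|).
have n := @normr_ge0 R R.
have m0 : 0 < m.
  by rewrite /m; have := n (q.1 - c.1); have := n (q.2 - c.2);
    have := n (p.1 - c.1); have := n (p.2 - c.2); lra.
exists (e / m); first exact: divr_gt0.
move=> z w h1 h2.
have key a b : 0 <= a -> 0 <= b -> a + b + 1 <= m ->
  `|w.1 - z.1| * a + `|w.2 - z.2| * b < e.
  move=> a0 b0 ab; apply: (@le_lt_trans _ _ (e / m * (a + b))).
    by rewrite mulrDr lerD // ler_wpM2r // ltW.
  rewrite -mulrA -[ltRHS]mulr1 ltr_pM2l // mulrC ltr_pdivrMr // mul1r; lra.
have tri (a b a' b' x : R) : (x + a * a' + b * b') = x + (a * a' + b * b') by ring.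
split; rewrite /= /ball /= ?frame1 ?frame2.
  rewrite distrC !tri opprD addrACA subrr add0r opprD addrACA -!mulrBl.
  apply: le_lt_trans (ler_normD _ _) _; rewrite !normrM; apply: key => //.
  by rewrite /m; have := n (q.2 - c.2); have := n (p.2 - c.2); lra.
rewrite distrC !tri opprD addrACA subrr add0r opprD addrACA -!mulrBl.
apply: le_lt_trans (ler_normD _ _) _; rewrite !normrM; apply: key => //.
by rewrite /m; have := n (q.1 - c.1); have := n (p.1 - c.1); lra.
Qed.

End Frame.

Section NormalForm.
Variables (R : realType) (S : set (R * R)) (c p q : R * R).
Local Notation plane := (R * R)%type.
Hypotheses (shapeS : plane_shape S) (convexS : convex_set S)
  (side_l : side S c p) (side_b : side S c q)
  (orth_lb : orthogonal_vec (p - c) (q - c))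
  (S_sub_rect : S `<=` spanned_rectangle c p q)
  (not_parallel : forall x y : plane, side S x y ->
    seg x y <> seg c p -> seg x y <> seg c q ->
    ~ parallel_vec (y - x) (p - c) /\ ~ parallel_vec (y - x) (q - c)).
Local Notation phi := (frame c p q).
Let Q s t := S (phi (s, t)).

Lemma frame_inj : injective phi.
Proof. by case: side_l => cp _ _; case: side_b => cq _ _; apply: orthogonal_frame_inj. Qed.

Lemma seg_left (x y : plane) : seg x y x.
Proof. by exists 0; rewrite ?scale0r ?addr0 //= in_itv /= lexx ler01. Qed.

Lemma seg_right (x y : plane) : seg x y y.
Proof. by exists 1; rewrite ?scale1r ?subrKC //= in_itv /= lexx ler01. Qed.

Lemma frame00 : phi (0, 0) = c.
Proof. by apply: plane_eq; rewrite ?frame1 ?frame2 /=; ring. Qed.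

Lemma frame01 : phi (0, 1) = p.
Proof. by apply: plane_eq; rewrite ?frame1 ?frame2 /=; ring. Qed.

Lemma frame10 : phi (1, 0) = q.
Proof. by apply: plane_eq; rewrite ?frame1 ?frame2 /=; ring. Qed.

Lemma boundary_sub : boundary S `<=` S.
Proof. by move=> x [cx _]; case: shapeS => /closure_id -> _. Qed.

Lemma S_frame x : S x -> exists z : plane,
  [/\ x = phi z, 0 <= z.1 <= 1 & 0 <= z.2 <= 1].
Proof.
move=> /S_sub_rect[s [t [hs ht ->]]]; exists (t, s); split => //.
by apply: plane_eq; rewrite ?frame1 ?frame2 /= /GRing.scale /=; ring.
Qed.

Lemma S_box s t : Q s t -> (0 <= s <= 1) /\ (0 <= t <= 1).
Proof. by move=> /S_frame[z [/frame_inj <- ]]. Qed.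

Lemma S_frame_convex (z w : plane) k : S (phi z) -> S (phi w) -> 0 <= k <= 1 ->
  S (phi (z + k *: (w - z))).
Proof.
move=> Sz Sw /andP[k0 k1]; rewrite frame_affine.
have /set_mem := convexS (Itv01 k0 k1) (mem_set Sw) (mem_set Sz).
congr S; apply: plane_eq; rewrite /= /unstable.onem /GRing.scale /=; ring.
Qed.

Lemma S_corner : Q 0 0.
Proof.
rewrite /Q frame00; apply: boundary_sub; case: side_l => _ + _; apply.
exact: seg_left.
Qed.

Lemma S_right_tip : Q 1 0.
Proof.
rewrite /Q frame10; apply: boundary_sub; case: side_b => _ + _; apply.
exact: seg_right.
Qed.

Lemma S_top_tip : Q 0 1.
Proof.
rewrite /Q frame01; apply: boundary_sub; case: side_l => _ + _; apply.
exact: seg_right.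
Qed.

Lemma S_between s t s' t' k : Q s t -> Q s' t' -> 0 <= k <= 1 ->
  Q (s + k * (s' - s)) (t + k * (t' - t)).
Proof. exact: (@S_frame_convex (s, t) (s', t')). Qed.

Lemma S_left_of s s' t : Q 0 t -> Q s t -> 0 <= s' <= s -> Q s' t.
Proof.
move=> Q0 Qs /andP[s0 ss]; have [s_0|s_0] := eqVneq s 0.
  by have -> : s' = 0 by lra.
have sp : 0 < s by lra.
have -> : s' = 0 + s' / s * (s - 0) by field.
have -> : t = t + s' / s * (t - t) by ring.
by apply: S_between => //; rewrite divr_ge0 ?(ltW sp) //= ler_pdivrMr // mul1r.
Qed.

Lemma S_below s t t' : Q s 0 -> Q s t -> 0 <= t' <= t -> Q s t'.
Proof.
move=> Q0 Qs /andP[t0 tt]; have [t_0|t_0] := eqVneq t 0.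
  by have -> : t' = 0 by lra.
have tp : 0 < t by lra.
have -> : t' = 0 + t' / t * (t - 0) by field.
have -> : s = s + t' / t * (s - s) by ring.
by apply: S_between => //; rewrite divr_ge0 ?(ltW tp) //= ler_pdivrMr // mul1r.
Qed.

(** Convexity is used along horizontal and vertical segments whose one end lies on a leg of the
    corner. *)
Lemma S_down s t s' t' : Q s t -> 0 <= s' <= s -> 0 <= t' <= t -> Q s' t'.
Proof.
move=> Qst hs ht; have [/andP[s0 s1] /andP[t0 t1]] := S_box Qst.
have Q0t : Q 0 t by apply: (S_below S_corner S_top_tip); rewrite t0.
have Qs'0 : Q s' 0 by apply: (S_left_of S_corner S_right_tip); lra.
by apply: (S_below Qs'0 _ ht); apply: S_left_of hs.
Qed.

Lemma S_frame_open s t : ~ Q s t -> exists2 d, 0 < d &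
  forall s' t', `|s' - s| < d -> `|t' - t| < d -> ~ Q s' t'.
Proof.
move=> nQ; have oS : open (~` S) by apply: closed_openC; case: shapeS.
have /nbhs_ballP[e /= e0 eS] := open_nbhs_nbhs (conj oS nQ).
have [d d0 hd] := frame_near c p q e0; exists d => // s' t' hs ht.
exact/eS/(hd (s, t) (s', t')).
Qed.

Lemma S_right_boundary t : Q 1 t -> boundary S (phi (1, t)).
Proof.
move=> Qt; split; first exact: subset_closure.
move=> /nbhs_ballP[e /= e0 eS]; have [d d0 hd] := frame_near c p q e0.
have : Q (1 + d / 2) t.
  by apply/eS/(hd (1, t)); rewrite /= ?subrr ?normr0 // addrC addKr ger0_norm; lra.
by move=> /S_box[/andP[_ ?] _]; lra.
Qed.

(** Otherwise the longest segment of S going up from the right tip on the line s = 1 would be a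
    further side parallel to [p - c]. Its upper end [m] is attained since S is closed. *)
Lemma S_no_right_side t : 0 < t -> ~ Q 1 t.
Proof.
move=> t0 Qt; pose E := [set y | Q 1 y].
have E_ub : ubound E 1 by move=> y /S_box[_ /andP[]].
have supE : has_sup E by split; [exists t|exists 1].
pose m := sup E.
have Em y : Q 1 y -> y <= m by move=> Qy; apply: sup_upper_bound.
have m0 : 0 < m by apply: lt_le_trans t0 (Em _ Qt).
have Qm : Q 1 m.
  apply: contrapT => /S_frame_open[d d0 hd].
  have [y Ey yd] := sup_adherent d0 supE.
  by apply: (hd 1 y) (Ey); rewrite ?subrr ?normr0 // ler0_norm;
    have := Em _ Ey; rewrite -/m in yd; lra.
have Qle y : 0 <= y <= m -> Q 1 y by apply: S_below => //; exact: S_right_tip.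
pose r := phi (1, m).
have segE y : phi (1, y) = q + (y / m) *: (r - q).
  transitivity (phi ((1, 0) + (y / m) *: ((1, m) - (1, 0)))); last first.
    by rewrite frame_affine frame10.
  congr phi; apply: plane_eq; rewrite /= /GRing.scale /=; first by ring.
  by field; rewrite gt_eqF.
have seg1 x : seg q r x -> exists2 y, 0 <= y <= m & x = phi (1, y).
  move=> [k]; rewrite /= in_itv /= => /andP[k0 k1] <-.
  by exists (k * m); [nra|rewrite segE mulfK // gt_eqF].
have sr : side S q r.
  split.
  - by apply/eqP => /(etrans frame10)/frame_inj[m_0]; rewrite -m_0 ltxx in m0.
  - by move=> x /seg1[y hy ->]; apply/S_right_boundary/Qle.
  (* Maximality: the larger segment passes through [q] and [r], so its abscissa equals 1 at two
     distinct parameters and is constant; its ordinates then lie between 0 and [m]. *)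
  move=> x y sub sS; apply/seteqP; split => //.
  have [zx [xE /andP[x0 x1] _]] := S_frame (boundary_sub (sS _ (seg_left x y))).
  have [zy [yE /andP[y0 y1] _]] := S_frame (boundary_sub (sS _ (seg_right x y))).
  have [k0 /= hk0 k0E] := sub _ (seg_left q r).
  have [k1 /= hk1 k1E] := sub _ (seg_right q r).
  move: hk0 hk1; rewrite !in_itv /= => /andP[k00 k01] /andP[k10 k11].
  have a0 : zx.1 + k0 * (zy.1 - zx.1) = 1.
    move: k0E; rewrite xE yE -frame_affine => H.
    by have := etrans H (esym frame10); move=> /frame_inj /(congr1 fst); rewrite /= /GRing.scale.
  have a1 : zx.1 + k1 * (zy.1 - zx.1) = 1.
    move: k1E; rewrite xE yE -frame_affine => /frame_inj /(congr1 fst).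
    by rewrite /= /GRing.scale.
  have k01n : k0 != k1.
    apply: contraTneq m0 => k01E; move: k1E; rewrite -k01E k0E.
    by move=> /(etrans frame10)/frame_inj[<-]; rewrite ltxx.
  have d0 : zy.1 - zx.1 = 0.
    have /eqP : (k0 - k1) * (zy.1 - zx.1) = 0 by lra.
    by rewrite mulf_eq0 subr_eq0 (negbTE k01n) => /eqP.
  have zx1 : zx.1 = 1 by move: a0; rewrite d0; lra.
  have zy1 : zy.1 = 1 by lra.
  have on (z : plane) x' : x' = phi z -> z.1 = 1 -> S x' -> 0 <= z.2 <= m.
    move=> -> z1; rewrite [z]surjective_pairing z1 => Qz /=.
    by have [_ /andP[-> _]] := S_box Qz; rewrite Em.
  have bx := on _ _ xE zx1 (boundary_sub (sS _ (seg_left x y))).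
  have by_ := on _ _ yE zy1 (boundary_sub (sS _ (seg_right x y))).
  move=> _ [k /= kI <-]; move: kI; rewrite in_itv /= => /andP[kk0 kk1].
  rewrite xE yE -frame_affine.
  have -> : zx + k *: (zy - zx) = (1, zx.2 + k * (zy.2 - zx.2)).
    by apply: plane_eq; rewrite /= ?zx1 ?zy1 /GRing.scale //=; ring.
  rewrite segE; exists ((zx.2 + k * (zy.2 - zx.2)) / m) => //=.
  rewrite in_itv /= ler_pdivrMr // mul1r divr_ge0 ?(ltW m0) //=; nra.
have qr_l : seg q r <> seg c p.
  move=> e; have := seg_left q r; rewrite e => -[k _].
  move=> H.
  have : phi ((0, 0) + k *: ((0, 1) - (0, 0))) = phi (1, 0).
    by rewrite frame_affine frame00 frame01 frame10.
  by move=> /frame_inj /(congr1 fst); rewrite /= /GRing.scale /=; lra.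
have qr_b : seg q r <> seg c q.
  move=> e; have := seg_left c q; rewrite -e => -[k _] H.
  have : phi ((1, 0) + k *: ((1, m) - (1, 0))) = phi (0, 0).
    by rewrite frame_affine frame10 frame00.
  by move=> /frame_inj /(congr1 fst); rewrite /= /GRing.scale /=; lra.
have [+ _] := not_parallel sr qr_l qr_b; apply.
rewrite /parallel_vec /r /= /GRing.scale /=; ring.
Qed.

(** The centre (1/3, 1/3) of the shrinking lies in S because it is below (1/2, 1/2). Thinness holds
    since a point (1, t) with t > 0 is outside the closed set S, together with a neighbourhood. *)
Lemma S_corner_shape : corner_shape Q.
Proof.
have Qhalf : Q 2^-1 2^-1.
  have := S_between (k := 2^-1) S_right_tip S_top_tip.
  have -> : 1 + 2^-1 * (0 - 1) = 2^-1 :> R by field.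
  have -> : 0 + 2^-1 * (1 - 0) = 2^-1 :> R by field.
  by apply; lra.
split; [exact: S_box|exact: S_down|exact: S_right_tip|exact: S_top_tip|exact: Qhalf| |].
  move=> s t k Qst hk; apply: S_between Qst hk.
  by apply: (S_down Qhalf); lra.
move=> t t0; have [d d0 hd] := S_frame_open (S_no_right_side t0).
exists d => // s s1 Qs; have [/andP[_ s2] _] := S_box Qs.
by apply: hd Qs; rewrite ?subrr ?normr0 // ler0_norm; lra.
Qed.

Lemma S_frameE : S = [set phi z | z in [set z | Q z.1 z.2]].
Proof.
apply/seteqP; split => [x Sx|_ [[s t] Qst <-]//].
by have [[s t] [xE _ _]] := S_frame Sx; exists (s, t) => //=; rewrite /Q -xE.
Qed.
End NormalForm.

(** * Copies that overlap only negligibly *)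

Section Pieces.
Variables (R : realType) (Q : R -> R -> Prop) (q : nat).
Hypotheses (Qs : corner_shape Q) (q0 : (0 < q)%N).
Local Notation piece := (R * R * R)%type.
Local Notation eta := (q%:R^-1 : R).
Implicit Types (e f : piece) (v : R * R).

(* The piece ((x, y), r) stands for the copy (x, y) + r Q. Its core still contains
   a copy of ratio 1 - 3 / q, so that a family of copies is alpha-free for q large
   as soon as no copy meets the core of another one. *)
Definition core (s t : R) : Prop :=
  [/\ Q s t, eta <= s <= 1 - eta & eta <= t <= 1 - eta].

Definition touch e f : Prop := exists s t s' t',
  [/\ Q s t, Q s' t', e.1.1 + e.2 * s = f.1.1 + f.2 * s' &
      e.1.2 + e.2 * t = f.1.2 + f.2 * t'].

Definition avoids_core e f : Prop := forall s t s' t', Q s t -> core s' t' ->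
  e.1.1 + e.2 * s = f.1.1 + f.2 * s' ->
  e.1.2 + e.2 * t = f.1.2 + f.2 * t' -> False.

Definition apart e f : Prop := avoids_core e f /\ avoids_core f e.

Definition translate v e : piece := (v.1 + e.1.1, v.2 + e.1.2, e.2).

Lemma eta_gt0 : 0 < eta. Proof. by rewrite invr_gt0 ltr0n. Qed.

Lemma apart_sym e f : apart e f -> apart f e.
Proof. by case. Qed.

Lemma touch_sym e f : touch e f -> touch f e.
Proof. by move=> [s [t [s' [t' [? ? ? ?]]]]]; exists s', t', s, t. Qed.

Lemma apart_translate v e f : apart e f -> apart (translate v e) (translate v f).
Proof.
move=> [ef fe]; split=> s t s' t' Qst Cst; rewrite /= -!addrA => /addrI h1 /addrI h2.
  exact: (ef s t s' t').
exact: (fe s t s' t').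
Qed.

Lemma touch_translate v e f : touch e f -> touch (translate v e) (translate v f).
Proof.
move=> [s [t [s' [t' [? ? h1 h2]]]]]; exists s, t, s', t'.
by split => //; rewrite /= -!addrA ?h1 ?h2.
Qed.

Lemma translateD v w e : translate v (translate w e) = translate (v.1 + w.1, v.2 + w.2) e.
Proof. by rewrite /translate /= !addrA. Qed.

(** The copy [e] may enter [f] from the left, as long as the depth is less than 1/q times either
    size: the cores keep this margin. *)
Lemma apart_left e f : 0 < e.2 -> 0 < f.2 ->
  e.1.1 + e.2 < f.1.1 + eta * f.2 -> e.1.1 + (1 - eta) * e.2 < f.1.1 -> apart e f.
Proof.
move=> e0 f0 h1 h2; split=> s t s' t' Qst [_ /andP[s1 s2] _] E _;
  have [/andP[? ?] _] := corner_box Qs Qst.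
  have : e.2 * s <= e.2 by rewrite ger_pMr.
  have : eta * f.2 <= f.2 * s' by rewrite mulrC ler_wpM2l // ltW.
  lra.
have : 0 <= f.2 * s by rewrite mulr_ge0 // ltW.
have : e.2 * s' <= (1 - eta) * e.2 by rewrite mulrC ler_wpM2r // ltW.
lra.
Qed.

Lemma apart_below e f : 0 < e.2 -> 0 < f.2 ->
  e.1.2 + e.2 < f.1.2 + eta * f.2 -> e.1.2 + (1 - eta) * e.2 < f.1.2 -> apart e f.
Proof.
move=> e0 f0 h1 h2; split=> s t s' t' Qst [_ _ /andP[s1 s2]] _ E;
  have [_ /andP[? ?]] := corner_box Qs Qst.
  have : e.2 * t <= e.2 by rewrite ger_pMr.
  have : eta * f.2 <= f.2 * t' by rewrite mulrC ler_wpM2l // ltW.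
  lra.
have : 0 <= f.2 * t by rewrite mulr_ge0 // ltW.
have : e.2 * t' <= (1 - eta) * e.2 by rewrite mulrC ler_wpM2r // ltW.
lra.
Qed.

Lemma apart_left0 e f : 0 < e.2 -> 0 < f.2 -> e.1.1 + e.2 <= f.1.1 -> apart e f.
Proof.
move=> e0 f0 h; have := eta_gt0 => h0.
have ? : 0 < eta * e.2 by exact: mulr_gt0.
have ? : 0 < eta * f.2 by exact: mulr_gt0.
by apply: apart_left => //; lra.
Qed.

Lemma apart_below0 e f : 0 < e.2 -> 0 < f.2 -> e.1.2 + e.2 <= f.1.2 -> apart e f.
Proof.
move=> e0 f0 h; have := eta_gt0 => h0.
have ? : 0 < eta * e.2 by exact: mulr_gt0.
have ? : 0 < eta * f.2 by exact: mulr_gt0.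
by apply: apart_below => //; lra.
Qed.

Lemma corner_origin : Q 0 0.
Proof. by apply: (corner_down Qs (corner_right Qs)); rewrite lexx ?ler01. Qed.

Lemma touch_top e f : 0 < f.2 -> e.1.1 = f.1.1 -> e.1.2 + e.2 = f.1.2 -> touch e f.
Proof.
move=> f0 h1 h2; exists 0, 1, 0, 0; split; rewrite ?mulr0 ?mulr1 ?addr0 //.
  exact: corner_top.
exact: corner_origin.
Qed.

Lemma touch_right e f : 0 < f.2 -> e.1.1 + e.2 = f.1.1 -> e.1.2 = f.1.2 -> touch e f.
Proof.
move=> f0 h1 h2; exists 1, 0, 0, 0; split; rewrite ?mulr0 ?mulr1 ?addr0 //.
  exact: corner_right.
exact: corner_origin.
Qed.

End Pieces.

(** * Touch graphs and their realization by copies of the shape *)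

Section TouchGraph.
Variables (R : realType) (Q : R -> R -> Prop) (V : finType) (loc : V -> R * R * R).

Definition touch_rel : rel V := fun u v => (u != v) && `[< touch Q (loc u) (loc v) >].

Lemma touch_rel_sym : symmetric touch_rel.
Proof.
move=> u v; rewrite /touch_rel eq_sym; congr (_ && _).
by apply/asboolP/asboolP; exact: touch_sym.
Qed.

Lemma touch_rel_irr : irreflexive touch_rel.
Proof. by move=> u; rewrite /touch_rel eqxx. Qed.

Definition touch_graph : graph := Graph touch_rel_sym touch_rel_irr.
End TouchGraph.

Section Realization.
Variables (R : realType) (S : set (R * R)) (c p r : R * R).
Local Notation plane := (R * R)%type.
Local Notation phi := (frame c p r).
Variable Q : R -> R -> Prop.
Hypotheses (closedS : closed S) (phi_inj : injective phi)
  (SE : S = [set phi z | z in [set z | Q z.1 z.2]]) (Qs : corner_shape Q).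

Definition copy (e : R * R * R) : set plane :=
  [set phi (e.1.1 + e.2 * z.1, e.1.2 + e.2 * z.2) | z in [set z : plane | Q z.1 z.2]].

Lemma copy_homothety e :
  copy e = [set (phi e.1 - e.2 *: c) + e.2 *: y | y in S].
Proof.
have frameE (z : plane) : phi (e.1.1 + e.2 * z.1, e.1.2 + e.2 * z.2) =
    phi e.1 - e.2 *: c + e.2 *: phi z.
  by apply: plane_eq; rewrite ?frame1 ?frame2 /= /GRing.scale /=; ring.
rewrite SE; apply/seteqP; split => [_ [z Qz <-]|_ [_ [z Qz <-] <-]].
  by exists (phi z); [exists z|rewrite frameE].
by exists z.
Qed.

Lemma area_copy e : 0 < e.2 -> area (copy e) = ((e.2 ^+ 2)%:E * area S)%E.
Proof.
by move=> e0; rewrite copy_homothety area_homothety //; exact: closed_plane_measurable.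
Qed.

Lemma measurable_copy e : 0 < e.2 ->
  measurable (copy e : set (measurableTypeR R * measurableTypeR R)).
Proof.
by move=> e0; rewrite copy_homothety; apply: measurable_homothety => //;
  exact: closed_plane_measurable.
Qed.

Lemma copy_meet e f : copy e `&` copy f !=set0 <-> touch Q e f.
Proof.
split=> [[_ [[z Qz <-] [w Qw]]]|[s [t [s' [t' [Q1 Q2 h1 h2]]]]]].
  by move=> /phi_inj[h1 h2]; exists z.1, z.2, w.1, w.2.
exists (phi (e.1.1 + e.2 * s, e.1.2 + e.2 * t)); split; first by exists (s, t).
by exists (s', t') => //=; rewrite h1 h2.
Qed.

(** Each core contains a copy [f] of relative size [l] that no other copy meets; its share of the
    area is [l ^+ 2]. *)
Lemma free_touch_graph (alpha : R) (q : nat) (V : finType) (loc : V -> R * R * R) :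
  (3 < q)%N -> alpha <= (1 - 3 / q%:R) ^+ 2 -> (forall v, 0 < (loc v).2) ->
  (forall u v, u != v -> apart Q q (loc u) (loc v)) ->
  free_homothets_class S alpha (touch_graph Q loc).
Proof.
move=> q3 alpha_le loc0 loc_apart; exists (fun v => copy (loc v)); split.
- by move=> v; exists (loc v).2, (phi (loc v).1 - (loc v).2 *: c); rewrite copy_homothety.
- move=> v; have qp : 0 < q%:R :> R by rewrite ltr0n; case: (q) q3.
  have h3 : 3 * q%:R^-1 < 1 :> R by rewrite ltr_pdivrMr // mul1r ltr_nat.
  have e0 : 0 < q%:R^-1 :> R by rewrite invr_gt0.
  pose l : R := 1 - 3 / q%:R; have l0 : 0 < l by rewrite /l; lra.
  (* As 1/q = (1 - l)/3, this is the image of the copy under the homothety of ratio [l] centred at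
     its point (1/3, 1/3), as in [corner_shrink]. *)
  pose f := ((loc v).1.1 + (loc v).2 / q%:R, (loc v).1.2 + (loc v).2 / q%:R,
    l * (loc v).2).
  have f0 : 0 < f.2 by rewrite mulr_gt0.
  have mD : measurable (copy (loc v) `\` \bigcup_(u in [set u | u != v]) copy (loc u)
      : set (measurableTypeR R * measurableTypeR R)).
    apply: measurableD; first exact: measurable_copy.
    apply: fin_bigcup_measurable => [|u _]; first exact: finite_finset.
    exact: measurable_copy.
  apply: (@le_trans _ _ (area (copy f))).
    rewrite !area_copy // muleA -EFinM; apply: lee_wpmul2r; first exact: measure_ge0.
    by rewrite lee_fin exprMn ler_wpM2r // sqr_ge0.
  apply: le_measure; rewrite ?inE //; first exact: measurable_copy.
  have coreE (z : plane) : Q z.1 z.2 ->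
      core Q q (q%:R^-1 + l * z.1) (q%:R^-1 + l * z.2).
    move=> Qz; have [/andP[z1 z1'] /andP[z2 z2']] := corner_box Qs Qz.
    have lE : q%:R^-1 = 3^-1 - l * 3^-1 :> R by rewrite /l; field; rewrite gt_eqF.
    have lz (x : R) : 0 <= x -> x <= 1 -> 0 <= l * x <= l.
      by move=> x0 x1; rewrite mulr_ge0 ?(ltW l0) //= ger_pMr.
    split; [|have := lz z.1 z1 z1'; rewrite /l; lra|have := lz z.2 z2 z2'; rewrite /l; lra].
    have := corner_shrink Qs (k := l) Qz; rewrite !mulrBr lE.
    rewrite -!addrA ![- _ + _]addrC; apply; rewrite /l; lra.
  move=> _ [z Qz <-]; split.
    exists (q%:R^-1 + l * z.1, q%:R^-1 + l * z.2); first by case: (coreE z Qz).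
    by congr phi; rewrite /f /=; congr pair; ring.
  move=> [u /= uv [w Qw /phi_inj[h1 h2]]].
  have [av _] := loc_apart u v uv.
  apply: (av w.1 w.2 _ _ Qw (coreE z Qz)); rewrite ?h1 ?h2 /f /=; ring.
- move=> u v; rewrite /= /touch_rel copy_meet; split.
    by move=> /andP[uv /asboolP].
  by move=> [uv /asboolP h]; rewrite uv.
Qed.
End Realization.

(** * Wires crossing a row of hubs *)

Section Track.
Variables (R : realType) (Q : R -> R -> Prop) (q : nat).
Hypotheses (Qs : corner_shape Q) (q0 : (0 < q)%N).
Local Notation piece := (R * R * R)%type.
Local Notation eta := (q%:R^-1 : R).

(** The factor 2 makes [M] columns reach exactly to the middle of a hub. *)
Definition mesh (M : nat) : R := (2 * M)%:R^-1.

(* The point with (negative) abscissa -c mesh and ordinate r mesh lies in the copy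
   of Q whose right tip is the origin, i.e. in the left neighbour of the hub at 0. *)
Definition under (M c r : nat) : Prop := Q (1 - c%:R * mesh M) (r%:R * mesh M).

(* The wire of mesh [mesh M] pokes the hub by [offset M]; its lowest cell lies at
   height [level M L], where it meets the top tip of the foot, a copy of size
   [foot_size M L]. Both overlaps have depth less than 1/q times the size. *)
Definition offset (M : nat) : R := mesh M / (2 * q)%:R.
Definition level (M L : nat) : R := offset M + L%:R * mesh M.
Definition foot_size (M L : nat) : R := q%:R * (L.+1)%:R * mesh M.

(** [L] is the first row in which column 1 clears the neighbouring hub; the wire starts there. *)
Definition track (M L : nat) : Prop :=
  [/\ (0 < M)%N, ~ under M 1 L & forall r, (r < L)%N -> under M 1 r].

Lemma mesh_gt0 M : (0 < M)%N -> 0 < mesh M.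
Proof. by move=> M0; rewrite invr_gt0 ltr0n muln_gt0. Qed.

Lemma mesh_half M : (0 < M)%N -> M%:R * mesh M = 2^-1.
Proof.
by move=> M0; rewrite /mesh natrM invfM mulrCA divff ?mulr1 // pnatr_eq0 -lt0n.
Qed.

Lemma mesh_mono M a b : (0 < M)%N -> (a <= b)%N -> a%:R * mesh M <= b%:R * mesh M.
Proof. by move=> M0 ab; rewrite ler_wpM2r ?ler_nat // ltW // mesh_gt0. Qed.

Lemma meshS M n : n.+1%:R * mesh M = n%:R * mesh M + mesh M.
Proof. by rewrite -natr1 mulrDl mul1r. Qed.

Lemma mesh_le1 M c : (0 < M)%N -> (c <= 2 * M)%N -> c%:R * mesh M <= 1.
Proof.
move=> M0 cM; apply: le_trans (mesh_mono M0 cM) _.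
by rewrite natrM -mulrA mesh_half // divff.
Qed.

Lemma under_mono M c r c' r' : (0 < M)%N -> under M c r ->
  (c <= c')%N -> (r' <= r)%N -> (c' <= 2 * M)%N -> under M c' r'.
Proof.
move=> M0 u cc rr c2; apply: (corner_down Qs u).
  by have := mesh_le1 M0 c2; have := mesh_mono M0 cc; lra.
rewrite mesh_mono // mulr_ge0 // ltW // mesh_gt0 //.
Qed.

Lemma under0 M c : (0 < M)%N -> (c <= 2 * M)%N -> under M c 0.
Proof.
move=> M0 cM; rewrite /under mul0r; apply: (corner_down Qs (corner_right Qs)).
  by have := mesh_le1 M0 cM; have := mesh_mono M0 (leq0n c); rewrite mul0r; lra.
by rewrite lexx.
Qed.

Lemma not_under_high M c r : (0 < M)%N -> (2 * M < r)%N -> ~ under M c r.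
Proof.
move=> M0 Mr /(corner_box Qs)[_ /andP[_]].
have := mesh_mono M0 Mr; rewrite -[(2 * M).+1]addn1 natrD mulrDl natrM -mulrA mesh_half //.
have := mesh_gt0 M0; lra.
Qed.

Lemma track_L M L : track M L -> (0 < L <= (2 * M).+1)%N.
Proof.
move=> [M0 nL uL]; apply/andP; split.
  by rewrite lt0n; apply/eqP => L0; subst L; apply: nL; apply: under0 => //; lia.
by rewrite leqNgt; apply/negP => h; apply: (not_under_high M0 (ltnSn _) (uL _ h)).
Qed.

Lemma exists_track M : (0 < M)%N -> exists L, track M L.
Proof.
move=> M0; have ex : exists L, `[< ~ under M 1 L >].
  by exists (2 * M).+1; apply/asboolP; exact: not_under_high.
case: (ex_minnP ex) => L /asboolP nL minL; exists L; split => // r rL.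
by apply: contrapT => /asboolP/minL; rewrite leqNgt rL.
Qed.

(** Although the foot is [q] times larger than the height it has to bridge, it can be made small: by
    thinness, a mesh below [d] lets column 1 leave the neighbouring hub below height [tau]. *)
Lemma small_track (e : R) : 0 < e -> exists M L,
  [/\ track M L, offset M + 2 * mesh M < e & offset M + foot_size M L < e].
Proof.
move=> e0; have q1 : 1 <= q%:R :> R by rewrite ler1n.
have qp : 0 < q%:R :> R by rewrite ltr0n.
(* With this choice the foot has size at most q (tau + 2 mesh) <= 3 q tau = 3 e / 8. *)
pose tau := e / (8 * q%:R).
have tau0 : 0 < tau by rewrite divr_gt0 // mulr_gt0.
have qtau : q%:R * tau = e / 8 by rewrite /tau; field; rewrite gt_eqF.
have [d d0 hd] := corner_thin Qs tau0.
have [M M0 [Md Mt]] : exists2 M, (0 < M)%N & mesh M < d /\ mesh M < tau.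
  pose m := Num.min d tau; have m0 : 0 < m by rewrite lt_min d0.
  exists (Num.bound m^-1).+1 => //.
  suff : mesh (Num.bound m^-1).+1 < m by rewrite /m lt_min => /andP[].
  rewrite /mesh -[ltRHS]invrK ltf_pV2 ?posrE ?invr_gt0 ?ltr0n //.
  apply: lt_le_trans (archi_boundP _) _; first by rewrite invr_ge0 ltW.
  by rewrite ler_nat; lia.
have [L tL] := exists_track M0; exists M, L.
have mp := mesh_gt0 M0.
have Lle : L%:R * mesh M <= tau + mesh M.
  (* Row [L] minus one is still under the hub, hence not above [tau]. *)
  have /andP[L0 _] := track_L tL; case: L tL L0 => // L [_ _ /(_ L (ltnSn _)) uL] _.
  rewrite -addn1 natrD mulrDl mul1r lerD2r leNgt; apply/negP => tL.
  apply: (hd (1 - 1%:R * mesh M)); first by rewrite mul1r; lra.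
  apply: (corner_down Qs uL); first by have [/andP[-> _] _] := corner_box Qs uL; rewrite lexx.
  by rewrite !ltW.
have offle : offset M <= mesh M.
  rewrite /offset ler_pdivrMr ?ltr0n ?muln_gt0 // -[leLHS]mulr1 ler_pM2l //.
  by rewrite ler1n; lia.
have sle : foot_size M L <= 3 * (e / 8).
  rewrite /foot_size -addn1 natrD -mulrA mulrDl mul1r -qtau mulrCA.
  rewrite ler_pM2l //; lra.
have tle : tau <= e / 8 by rewrite -qtau ler_peMl // ltW.
split => //; lra.
Qed.

Lemma offset_gt0 M : (0 < M)%N -> 0 < offset M.
Proof. by move=> M0; rewrite divr_gt0 ?mesh_gt0 // ltr0n muln_gt0. Qed.

Lemma offset_eta M : (0 < M)%N -> offset M < eta * mesh M.
Proof.
move=> M0; rewrite /offset mulrC ltr_pM2r ?mesh_gt0 //.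
by rewrite ltf_pV2 ?posrE ?ltr0n ?muln_gt0 //= ltr_nat; lia.
Qed.

Lemma level_eta M L : (0 < M)%N -> level M L < eta * foot_size M L.
Proof.
move=> M0; rewrite /level /foot_size -addn1 natrD !mulrA mulVf ?mul1r; last first.
  by rewrite pnatr_eq0 -lt0n.
rewrite mulrDl mul1r addrC ltrD2l; apply: lt_le_trans (offset_eta M0) _.
by rewrite ler_piMl ?(ltW (mesh_gt0 M0)) // invf_le1 ?ltr0n // ler1n.
Qed.

Lemma eta_le1 : eta <= 1.
Proof. by rewrite invf_le1 ?ltr0n // ler1n. Qed.

(** Recursive choice, each time with the previous offset as bound: foot k and column 0 of wire k end
    to the left of where those of every coarser wire begin. *)
Lemma exists_tracks : exists M L : nat -> nat,
  [/\ forall k, track (M k) (L k),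
      forall k, offset (M k) + foot_size (M k) (L k) < 4^-1,
      forall k, offset (M k) + 2 * mesh (M k) < 4^-1 &
      forall j k, (j < k)%N -> offset (M k) + 2 * mesh (M k) < offset (M j) /\
        offset (M k) + foot_size (M k) (L k) < offset (M j)].
Proof.
have ex (e : R) : exists ML : nat * nat, 0 < e -> [/\ track ML.1 ML.2,
    offset ML.1 + 2 * mesh ML.1 < e & offset ML.1 + foot_size ML.1 ML.2 < e].
  (* The pair (0, 0) is a dummy value for nonpositive bounds. *)
  have [e0|e0] := boolP (0 < e); last by exists (0, 0)%N.
  by have [M [L H]] := small_track e0; exists (M, L).
have [g hg] := boolp.choice ex.
pose f := fix f k := match k with 0 => g 4^-1 | k.+1 => g (offset (f k).1) end.
have f_track k : track (f k).1 (f k).2.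
  elim: k => [|k [M0 _ _]] /=; first by have [] := hg 4^-1 ltac:(lra).
  by have [] := hg _ (offset_gt0 M0).
have f_M k : (0 < (f k).1)%N by have [] := f_track k.
have step k : offset (f k.+1).1 + 2 * mesh (f k.+1).1 < offset (f k).1 /\
    offset (f k.+1).1 + foot_size (f k.+1).1 (f k.+1).2 < offset (f k).1.
  by have [] := hg _ (offset_gt0 (f_M k)).
have dec j k : (j <= k)%N -> offset (f k).1 <= offset (f j).1.
  elim: k => [|k IH]; first by rewrite leqn0 => /eqP->.
  rewrite leq_eqVlt => /orP[/eqP->//|/IH]; apply: le_trans.
  by have [+ _] := step k; have := mesh_gt0 (f_M k.+1); lra.
have off k : offset (f k).1 < 4^-1.
  apply: le_lt_trans (dec _ _ (leq0n k)) _ => /=.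
  have [[M0 _ _] + _] := hg 4^-1 ltac:(lra); have := mesh_gt0 M0; lra.
have rel j k : (j < k)%N -> offset (f k).1 + 2 * mesh (f k).1 < offset (f j).1 /\
    offset (f k).1 + foot_size (f k).1 (f k).2 < offset (f j).1.
  by case: k => // k jk; have [h1 h2] := step k; have := dec j k jk; lra.
exists (fun k => (f k).1), (fun k => (f k).2); split => //.
  case=> [|k]; first by have [] := hg 4^-1 ltac:(lra).
  by have [_ h] := step k; have := off k; lra.
case=> [|k]; first by have [] := hg 4^-1 ltac:(lra).
by have [h _] := step k; have := off k; lra.
Qed.
End Track.

(** * The nested wires and feet at one contact point *)

Section Gadget.
Variables (R : realType) (Q : R -> R -> Prop) (q : nat).
Hypotheses (Qs : corner_shape Q) (q2 : (1 < q)%N).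
Local Notation piece := (R * R * R)%type.
Local Notation eta := (q%:R^-1 : R).
Local Notation mesh := (mesh R).
Local Notation offset := (offset R q).
Local Notation under := (under Q).
Local Notation level := (level R q).
Local Notation foot_size := (foot_size R q).
Local Notation apart := (apart Q q).
Local Notation touch := (touch Q).
Variables (K : nat) (M L : nat -> nat).
Hypotheses (trackML : forall k, track Q (M k) (L k))
  (small_foot : forall k, offset (M k) + foot_size (M k) (L k) < 4^-1)
  (small_mesh : forall k, offset (M k) + 2 * mesh (M k) < 4^-1)
  (nested : forall j k, (j < k)%N -> offset (M k) + 2 * mesh (M k) < offset (M j) /\
        offset (M k) + foot_size (M k) (L k) < offset (M j)).

Let q0 : (0 < q)%N := ltnW q2.
Let M0 k : (0 < M k)%N. Proof. by case: (trackML k). Qed.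
Let rho0 k : 0 < mesh (M k) := mesh_gt0 R (M0 k).
Let off0 k : 0 < offset (M k) := offset_gt0 R q0 (M0 k).

(** Wire k turns at height k + 2, at most K + 1, which leaves at least 3 units of room below the
    next row. *)
Definition row_height : nat := (K + 4)%N.
Local Notation D := row_height.
Definition turn k : nat := ((k + 2) * (2 * M k))%N.
(** The upper end of this row is the bottom of the foot one row of hubs higher: in units of the
    mesh, 2 M D is the row height, q (L + 1) the size of the foot, and the last 1 the height of the
    cell itself. *)
Definition top_row k : nat := (2 * M k * D + L k - q * (L k).+1 - 1)%N.

(* The cells of the k-th wire: a staircase along the neighbouring hub from the
   contact point up to abscissa -1/2 (c = M k), a vertical segment up to height
   k + 2 (r = turn k), a horizontal one back to c = 0, and a vertical one up to the
   foot of the next row. Column c is the c-th one to the left of the axis. *)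
Inductive wire (k c r : nat) : Prop :=
| WireStair of (0 < c <= M k)%N & ~ under (M k) c r & (r <= turn k)%N &
    c = M k \/ under (M k) c.+1 r.-1
| WireRun of r = turn k & (c <= M k)%N
| WireUp of c = 0%N & (turn k <= r <= top_row k)%N.

Definition cell k c r : piece :=
  (offset (M k) - c%:R * mesh (M k), offset (M k) + r%:R * mesh (M k), mesh (M k)).

Definition foot k : piece :=
  (offset (M k), level (M k) (L k) - foot_size (M k) (L k), foot_size (M k) (L k)).

Lemma foot_size_gt0 k : 0 < foot_size (M k) (L k).
Proof. by rewrite !mulr_gt0 ?ltr0n. Qed.

Lemma level_gt0 k : 0 < level (M k) (L k).
Proof. by rewrite ltr_wpDr // mulr_ge0 // ltW. Qed.

Lemma level_lt_foot k : level (M k) (L k) < foot_size (M k) (L k).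
Proof.
apply: lt_le_trans (level_eta R q0 (L k) (M0 k)) _.
by rewrite ler_piMl ?eta_le1 // ltW // foot_size_gt0.
Qed.

(** In units of the mesh, the foot is shorter than half a hub; this keeps the truncated subtractions
    in [top_row] exact. *)
Lemma foot_count k : (q * (L k).+1 < M k)%N.
Proof.
rewrite -(ltr_nat R) -(ltr_pM2r (rho0 k)) mesh_half // natrM.
have := small_foot k; have := off0 k; rewrite /foot_size; lra.
Qed.

Lemma turn_top k : (k < K)%N -> (turn k <= top_row k)%N.
Proof.
move=> kK; rewrite /turn /top_row /row_height; have := foot_count k; have := M0 k.
have : ((k + 2) * (2 * M k) + 3 * (2 * M k) <= 2 * M k * (K + 4))%N.
  by rewrite -mulnDl mulnC leq_mul2l; lia.
lia.
Qed.

Lemma turn_mesh k : (turn k)%:R * mesh (M k) = (k + 2)%:R.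
Proof. by rewrite /turn !natrM -!mulrA mesh_half // divff // mulr1. Qed.

Lemma top_mesh k : (k < K)%N -> offset (M k) + (top_row k)%:R * mesh (M k) + mesh (M k) =
  D%:R + level (M k) (L k) - foot_size (M k) (L k).
Proof.
move=> kK; have : ((top_row k) + 1 + q * (L k).+1 = 2 * M k * D + L k)%N.
  have : (0 < turn k)%N by rewrite /turn !muln_gt0 M0 addn2.
  have := turn_top kK; rewrite /top_row.
  by move: (turn k) (2 * M k * D + L k)%N (q * _)%N => a b d; lia.
move=> /(congr1 (fun n => n%:R : R)); rewrite !natrD !natrM => e.
have -> : (top_row k)%:R = 2 * (M k)%:R * D%:R + (L k)%:R - q%:R * (L k).+1%:R - 1 :> R.
  by lra.
rewrite /level /foot_size; set l : R := (L k).+1%:R.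
transitivity (2 * D%:R * ((M k)%:R * mesh (M k)) + offset (M k) +
  (L k)%:R * mesh (M k) - q%:R * l * mesh (M k)); first by ring.
by rewrite mesh_half // [D%:R]natrD; lra.
Qed.

(** Rows below [L k] are under the neighbouring hub in column 1, hence in all columns further left
    up to the middle; rows from [turn k] on lie at height at least 2, above that hub. *)
Lemma wire_facts k c r : (k < K)%N -> wire k c r ->
  [/\ (c <= M k)%N, ~ under (M k) c r, (L k <= r <= top_row k)%N &
      if c == 0%N then (turn k <= r)%N else (r <= turn k)%N].
Proof.
move=> kK; have tt := turn_top kK; have := M0 k => Mk.
have high c' r' : (turn k <= r')%N -> ~ under (M k) c' r'.
  move=> h; apply: (not_under_high Qs (M0 k)); apply: leq_trans h.
  rewrite /turn; apply: leq_trans (_ : 2 * (2 * M k) <= _)%N; first by lia.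
  by rewrite leq_mul2r; lia.
have /andP[_ LM] := track_L Qs q0 (trackML k).
have LH : (L k <= turn k)%N.
  apply: leq_trans LM _; rewrite /turn.
  apply: leq_trans (_ : 2 * (2 * M k) <= _)%N; first by lia.
  by rewrite leq_mul2r; lia.
case=> [/andP[c0 cM] nu rH _|-> cM|-> /andP[Hr rT]].
- split => //; last by case: (c) c0.
  rewrite (leq_trans rH tt) andbT leqNgt; apply/negP => rL; apply: nu.
  have [_ _ /(_ _ rL) u] := trackML k.
  by apply: (under_mono Qs (M0 k) u) => //; lia.
- by split => //; [exact: high|rewrite LH tt|case: ifP].
- by split => //; [exact: high|rewrite (leq_trans LH Hr)].
Qed.

Lemma wire_box k c r : (k < K)%N -> wire k c r ->
  let e := cell k c r in
  [/\ offset (M k) - 2^-1 <= e.1.1, e.1.1 + e.2 <= offset (M k) + mesh (M k),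
      level (M k) (L k) <= e.1.2 &
      e.1.2 + e.2 <= D%:R + level (M k) (L k) - foot_size (M k) (L k)] /\
  if c == 0%N then e.1.1 = offset (M k) /\ offset (M k) + (k + 2)%:R <= e.1.2
  else e.1.1 + e.2 <= offset (M k) /\
       e.1.2 + e.2 <= offset (M k) + (k + 2)%:R + mesh (M k).
Proof.
move=> kK /(wire_facts kK)[cM nu /andP[Lr rT]] side; rewrite /cell /=.
have h1 := mesh_mono R (M0 k) cM; have h2 := mesh_mono R (M0 k) Lr.
have h3 := mesh_mono R (M0 k) rT; rewrite mesh_half // in h1.
have h4 := mesh_mono R (M0 k) (leq0n c); rewrite mul0r in h4.
have h5 := top_mesh kK; have h6 := rho0 k; split.
  by split; rewrite /level; rewrite /level in h5; lra.
case: eqP side => [->|/eqP c0] side; have := mesh_mono R (M0 k) side; rewrite turn_mesh.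
  by rewrite mul0r subr0; split => //; lra.
have : 1%:R * mesh (M k) <= c%:R * mesh (M k) by apply: mesh_mono => //; rewrite lt0n.
by rewrite mul1r; lra.
Qed.

Lemma cell_size k c r : 0 < (cell k c r).2.
Proof. exact: rho0. Qed.

Lemma foot_size0 k : 0 < (foot k).2.
Proof. exact: foot_size_gt0. Qed.

Lemma apart_cells_same k c r c' r' : (c, r) <> (c', r') ->
  apart (cell k c r) (cell k c' r').
Proof.
wlog : c r c' r' / (c' < c)%N \/ (c = c' /\ r < r')%N => [H ne|].
  case: (ltngtP c' c) => cc; first by apply: H => //; left.
    by apply: apart_sym; apply: H; [left|exact/nesym].
  case: (ltngtP r r') => rr; [by apply: H => //; right| |by case: ne; rewrite cc rr].
  by apply: apart_sym; apply: H; [right|exact/nesym].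
move=> + _; have h0 := rho0 k.
move=> [cc|[<- rr]]; [apply: (apart_left0 Qs q0)|apply: (apart_below0 Qs q0)];
  rewrite ?cell_size //= /cell /=.
  have := mesh_mono R (M0 k) cc; rewrite meshS; lra.
have := mesh_mono R (M0 k) rr; rewrite meshS; lra.
Qed.

(* A staircase cell of the finer wire lies within 2 mesh of the neighbouring hub,
   whereas the cells of the coarser wire were moved away from it by the much
   larger offset of that wire. *)
Lemma apart_cells_nested j k c r c' r' : (j < k)%N -> (j < K)%N -> (k < K)%N ->
  wire j c r -> wire k c' r' -> apart (cell j c r) (cell k c' r').
Proof.
move=> jk jK kK wj wk; have [n1 _] := nested jk.
have [[bx1 bx2 by1 by2] side] := wire_box jK wj.
have [[bx1' bx2' by1' by2'] side'] := wire_box kK wk.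
have lt_h : ((j + 2)%:R + 1 <= (k + 2)%:R :> R) by rewrite natr1 ler_nat -addSn leq_add2r.
have sj := cell_size j c r; have sk := cell_size k c' r'.
have rj := rho0 j; have rk := rho0 k; have smj := small_mesh j.
have oj := off0 j; have ok := off0 k.
have above : c != 0%N -> offset (M k) + (k + 2)%:R <= (cell k c' r').1.2 ->
    apart (cell j c r) (cell k c' r').
  move=> c0 h; move: side; rewrite (negbTE c0) => -[_ h2].
  by apply: (apart_below0 Qs q0) => //; lra.
have right : c == 0%N -> apart (cell j c r) (cell k c' r').
  move=> c0; move: side; rewrite c0 => -[h1 _]; apply: apart_sym.
  by apply: (apart_left0 Qs q0) => //; lra.
have [/right//|c0] := boolP (c == 0%N).
case: wk => [/andP[c'0 c'M] nu' r'H cu|r'E c'M|c'E _].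
(* The leftmost column of the finer wire lies entirely to the left of the coarser wire, since its
   offset is so much smaller. *)
- have [c'E|c'ne] := eqVneq c' (M k).
    apply: apart_sym; apply: (apart_left0 Qs q0) => //.
    apply: le_trans bx1; rewrite /cell /= c'E mesh_half //; lra.
  have {}cu : under (M k) c'.+1 r'.-1 by case: cu => // cE; rewrite cE eqxx in c'ne.
  have [cM nu _ _] := wire_facts jK wj.
  have [h1|h1] := leP ((cell k c' r').1.1 + (cell k c' r').2) (cell j c r).1.1.
    by apply: apart_sym; apply: (apart_left0 Qs q0).
  have [h2|h2] := leP ((cell k c' r').1.2 + (cell k c' r').2) (cell j c r).1.2.
    by apply: apart_sym; apply: (apart_below0 Qs q0).
  (* If the cells overlap in both coordinates, the coarser cell is dominated by the position (c' +
     1, r' - 1), which is under the hub. The cell and the diagonal step cost one mesh each, whence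
     the 2 in [nested]. *)
  case: nu; apply: (corner_down Qs cu).
    have c1 := mesh_le1 R (M0 j) (leq_trans cM (leq_pmull (M j) (isT : 0 < 2)%N)).
    by move: h1 n1 rk c1; rewrite /cell /= meshS; lra.
  have r'0 : (0 < r')%N.
    rewrite lt0n; apply/eqP => r0; apply: nu'; rewrite r0.
    exact: (under0 Qs (M0 k) (leq_trans c'M (leq_pmull (M k) (isT : 0 < 2)%N))).
  apply/andP; split; first by rewrite mulr_ge0 // ltW.
  have : r'.-1%:R * mesh (M k) = r'%:R * mesh (M k) - mesh (M k).
    by rewrite -{2}(prednK r'0) meshS addrK.
  by move: h2 n1 rk; rewrite /cell /= => h2 n1 rk ->; lra.
- by apply: above => //; rewrite /cell /= r'E turn_mesh.
- by apply: above => //; move: side'; rewrite c'E eqxx => -[].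
Qed.

Lemma apart_feet j k : (j < k)%N -> apart (foot k) (foot j).
Proof.
move=> jk; have [_ n] := nested jk.
by apply: (apart_left0 Qs q0); rewrite ?foot_size0 //= ltW.
Qed.

(** A finer wire passes to the left of the foot, a coarser one starts above it, and its own wire
    starts at the height of its tip. *)
Lemma apart_foot_cell j k c r : (j < K)%N -> (k < K)%N -> wire k c r ->
  apart (foot j) (cell k c r).
Proof.
move=> jK kK w; have [[bx1 bx2 by1 by2] side] := wire_box kK w.
have [jk|kj|->] := ltngtP j k.
- have [n _] := nested jk; have := rho0 k => h.
  apply: apart_sym; apply: (apart_left0 Qs q0); rewrite ?foot_size0 ?cell_size //=.
  by move: bx2; rewrite /=; lra.
- have [_ n] := nested kj; have := level_lt_foot j; have := off0 j; have := rho0 k.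
  move=> h1 h2 h3; have : 0 <= (L k)%:R * mesh (M k) by rewrite mulr_ge0 // ltW.
  move=> h4; apply: (apart_below0 Qs q0); rewrite ?foot_size0 ?cell_size //.
  apply: le_trans by1; rewrite /= subrK {2}/level; lra.
- by apply: (apart_below0 Qs q0); rewrite ?foot_size0 ?cell_size //= subrK.
Qed.

Definition hub : piece := (0, 0, 1).
Definition lattice (dx dy : int) : R * R := (dx%:~R, dy%:~R * D%:R).

Variable B : nat.
(** [None] stands for the foot and [Some (c, r)] for a cell; the bound [B] makes the index type
    finite. *)
Definition slot : finType := ('I_K * option ('I_B * 'I_B))%type.
Definition used (i : slot) : Prop := if i.2 is Some cr then wire i.1 cr.1 cr.2 else True.
Definition place (i : slot) : piece :=
  if i.2 is Some cr then cell i.1 cr.1 cr.2 else foot i.1.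

Lemma place_size i : 0 < (place i).2.
Proof. by case: i => k [[c r]|] /=; [exact: cell_size|exact: foot_size0]. Qed.

Lemma place_box i : used i ->
  [/\ - 2^-1 <= (place i).1.1, (place i).1.1 + (place i).2 <= 4^-1,
      - 4^-1 <= (place i).1.2 & (place i).1.2 + (place i).2 <= D%:R].
Proof.
have D4 : 4 <= D%:R :> R by rewrite ler_nat leq_addl.
case: i => k cr /=; have h1 := off0 k; have h2 := level_gt0 k.
have h3 := level_lt_foot k; have h4 := small_mesh k; have h5 := small_foot k.
have h6 := rho0 k; case: cr => [[c r]|] /= w.
  have [[b1 b2 b3 b4] _] := wire_box (ltn_ord k) w.
  by move: b1 b2 b3 b4; rewrite /cell /= => b1 b2 b3 b4; split; lra.
by rewrite /foot /=; split; lra.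
Qed.

(** The delicate case is a cell against a foot exactly one row up. On the same wire the cell ends no
    higher than the bottom of that foot; on different wires column 0 is separated from it
    horizontally by nesting, and the other columns end far below it. *)
Lemma apart_next_row i j (dy : int) : used i -> used j -> 0 < dy ->
  apart (place i) (translate (lattice 0 dy) (place j)).
Proof.
move=> ui uj dy0.
have [_ _ _ i4] := place_box ui; have [_ _ j3 _] := place_box uj.
have D4 : 4 <= D%:R :> R by rewrite ler_nat leq_addl.
have si := place_size i; have sj := place_size j.
have dy1 : 1 <= dy%:~R :> R by rewrite ler1z.
have dyD : D%:R <= dy%:~R * D%:R :> R by rewrite ler_peMl // ler0n.
case: i ui i4 si => ki [[c r]|] /= ui i4 si; last first.
  apply: (apart_below0 Qs q0) => //=; rewrite subrK.
  have := level_lt_foot ki; have := small_foot ki; have := off0 ki; lra.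
case: j uj j3 sj => kj [[c' r']|] /= uj j3 sj.
  apply: (apart_below0 Qs q0) => //=.
  have [[_ _ h _] _] := wire_box (ltn_ord kj) uj; have := level_gt0 kj.
  by move: h i4 dyD; rewrite /=; lra.
have [dyE|dyE] := eqVneq dy 1; last first.
  have dy2 : 2 <= dy%:~R :> R by rewrite -[2]/(2%:~R) ler_int; lia.
  have : 2 * D%:R <= dy%:~R * D%:R :> R by rewrite ler_wpM2r.
  move=> h; apply: (apart_below0 Qs q0) => //=.
  by move: i4 j3; rewrite /=; lra.
rewrite {}dyE in dyD dy1 *; have [[_ _ _ h] side] := wire_box (ltn_ord ki) ui.
have [kk|kk|kk] := ltngtP kj ki.
- have [n _] := nested kk; case: eqP side => _ side.
    case: side => hx _; apply: (apart_left0 Qs q0) => //=.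
    by move: hx; rewrite /= mulr0z add0r => ->; have := rho0 ki; lra.
  case: side => _ side; apply: (apart_below0 Qs q0) => //=.
  have : (ki + 2)%:R + 3 <= D%:R :> R.
    by rewrite -natrD ler_nat /row_height -addnA -[(2 + 3)%N]/(1 + 4)%N addnA leq_add2r addn1.
  have := small_mesh ki; have := rho0 ki.
  by move: j3 side; rewrite /=; lra.
- have [_ n] := nested kk; case: eqP side => _ side.
    case: side => hx _; apply: apart_sym; apply: (apart_left0 Qs q0) => //=.
    by move: hx; rewrite /= mulr0z add0r => ->; lra.
  case: side => _ side; apply: (apart_below0 Qs q0) => //=.
  have : (ki + 2)%:R + 3 <= D%:R :> R.
    by rewrite -natrD ler_nat /row_height -addnA -[(2 + 3)%N]/(1 + 4)%N addnA leq_add2r addn1.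
  have := small_mesh ki; have := rho0 ki.
  by move: j3 side; rewrite /=; lra.
- by apply: (apart_below0 Qs q0) => //=; move: h; rewrite /= kk ?mulr1z mul1r; lra.
Qed.

(** In the same row, the hub at dx = 0 is poked by less than the margin of the cores, from the left
    by cells and from below by feet, while column 0 passes above it. The left neighbour, dx = -1, is
    avoided because no cell is under it. *)
Lemma apart_hub i (dx dy : int) : used i -> apart (place i) (translate (lattice dx dy) hub).
Proof.
move=> ui; have [i1 i2 i3 i4] := place_box ui.
have D4 : 4 <= D%:R :> R by rewrite ler_nat leq_addl.
have si := place_size i.
have [dy0|dy0|dy0] := ltgtP dy 0.
- apply: apart_sym; apply: (apart_below0 Qs q0) => //=; rewrite ?ltr01 // addr0.
  have dy1 : dy%:~R <= -1 :> R by rewrite -[-1]/((-1)%:~R) ler_int; lia.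
  have : dy%:~R * D%:R <= -1 * D%:R :> R by rewrite ler_wpM2r.
  by lra.
- apply: (apart_below0 Qs q0) => //=; rewrite ?ltr01 // addr0.
  apply: le_trans i4 _; rewrite ler_peMl // ?ler0n // ler1z //.
rewrite {}dy0; have [dx1|dx1] := leP 1 dx.
  apply: (apart_left0 Qs q0) => //=; rewrite ?ltr01 // addr0.
  have : 1 <= dx%:~R :> R by rewrite ler1z.
  by lra.
have e0 : 0 < eta by rewrite invr_gt0 ltr0n.
have e1 : eta <= 2^-1 by rewrite lef_pV2 ?posrE ?ltr0n // ler_nat.
case: i ui i1 i2 i3 i4 si => k [[c r]|] /= ui i1 i2 i3 i4 si; last first.
  have [dx0|dx0] := eqVneq dx 0.
    have hl := level_eta R q0 (L k) (M0 k).
    have := level_lt_foot k; have := small_foot k; have := off0 k => h1 h2 h3.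
    rewrite dx0; apply: (apart_below Qs) => //=; rewrite ?ltr01 // mul0r addr0.
      have : eta * foot_size (M k) (L k) < eta * 1 by rewrite ltr_pM2l //; lra.
      by lra.
    by rewrite mulrBl mul1r; lra.
  have : dx%:~R <= -1 :> R by rewrite -[-1]/((-1)%:~R) ler_int; lia.
  move=> h; apply: apart_sym; apply: (apart_left0 Qs q0) => //=; rewrite ?ltr01 // addr0.
  by have := off0 k; lra.
have [[w1 w2 w3 w4] side] := wire_box (ltn_ord k) ui.
have [c0|c0] := boolP (c == 0%N :> nat).
  rewrite c0 in side; case: side => _ side.
  apply: apart_sym; apply: (apart_below0 Qs q0) => //=; rewrite ?ltr01 // mul0r !addr0 add0r.
  by have := off0 k; have : 2 <= (k + 2)%:R :> R; [rewrite ler_nat leq_addl|move: side => /=; lra].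
rewrite (negbTE c0) in side; case: side => side _.
have [dx0|dx0] := eqVneq dx 0.
  rewrite dx0; apply: (apart_left Qs) => //=; rewrite ?ltr01 // addr0.
    have := offset_eta R q0 (M0 k); have : eta * mesh (M k) <= eta * 1.
      by rewrite ler_wpM2l ?(ltW e0) //; have := small_mesh k; have := off0 k; have := rho0 k; lra.
    by move: side; rewrite /=; lra.
  have := offset_eta R q0 (M0 k).
  by move: side; rewrite /= mulrBl mul1r; lra.
have [dxm1|dxm1] := eqVneq dx (-1); last first.
  have : dx%:~R <= -2 :> R by rewrite -[-2]/((-2)%:~R) ler_int; lia.
  move=> h; apply: apart_sym; apply: (apart_left0 Qs q0) => //=; rewrite ?ltr01 // addr0.
  by have := off0 k; move: w1 => /=; lra.
have [cM nu _ _] := wire_facts (ltn_ord k) ui.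
have c1 := mesh_le1 R (M0 k) (leq_trans cM (leq_pmull (M k) (isT : 0 < 2)%N)).
(* A common point dominates the position (c, r) without the offset, which would then be under the
   neighbour as S is down-closed. *)
have disj s t s' t' : Q s t -> Q s' t' ->
    (cell k c r).1.1 + (cell k c r).2 * s = -1 + s' ->
    (cell k c r).1.2 + (cell k c r).2 * t = t' -> False.
  move=> Qst Qst' /= ex ey; apply: nu; apply: (corner_down Qs Qst').
    have [/andP[s0 _] _] := corner_box Qs Qst.
    have h1 : 0 <= mesh (M k) * s by rewrite mulr_ge0 // ltW.
    by have h2 := off0 k; apply/andP; split; lra.
  have [_ /andP[t0 _]] := corner_box Qs Qst.
  have h1 : 0 <= mesh (M k) * t by rewrite mulr_ge0 // ltW.
  have h2 : 0 <= r%:R * mesh (M k) by rewrite mulr_ge0 // ltW.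
  by have h3 := off0 k; apply/andP; split; lra.
rewrite dxm1; split=> s t s' t' Q1 [Q2 _ _] /=; rewrite !mul1r !addr0 mul0r add0r.
  by move=> ex ey; apply: (disj s t s' t').
by move=> ex ey; apply: (disj s' t' s t).
Qed.

Lemma apart_place i j : used i -> used j -> i != j -> apart (place i) (place j).
Proof.
case: i j => ki [[c r]|] [kj [[c' r']|]] /= ui uj ne.
- have [kk|kk|kk] := ltngtP ki kj.
  + exact: apart_cells_nested.
  + by apply: apart_sym; exact: apart_cells_nested.
  move/val_inj: kk => kk; subst kj; apply: apart_cells_same => -[cc rr].
  by case/negP: ne; apply/eqP; congr (_, Some (_, _)); apply: val_inj.
- by apply: apart_sym; exact: apart_foot_cell.
- exact: apart_foot_cell.
have [kk|kk|kk] := ltngtP ki kj; [by apply: apart_sym; exact: apart_feet|exact: apart_feet|].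
by case/negP: ne; move/val_inj: kk => ->.
Qed.

(** A horizontal shift separates the gadgets because each is narrower than 1; a downward shift is an
    upward shift with the roles exchanged. *)
Lemma apart_lattice i j (dx dy : int) : used i -> used j ->
  [|| i != j, dx != 0 | dy != 0] -> apart (place i) (translate (lattice dx dy) (place j)).
Proof.
move=> ui uj; have [i1 i2 _ _] := place_box ui; have [j1 j2 _ _] := place_box uj.
have si := place_size i; have sj := place_size j.
have [dx0|dx0|->] := ltgtP dx 0.
- move=> _; apply: apart_sym; apply: (apart_left0 Qs q0) => //=.
  have : dx%:~R <= -1 :> R by rewrite -[-1]/((-1)%:~R) ler_int; lia.
  by lra.
- move=> _; apply: (apart_left0 Qs q0) => //=.
  have : 1 <= dx%:~R :> R by rewrite ler1z; lia.
  by lra.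
have [dy0|dy0|->] := ltgtP dy 0 => /=.
- move=> _; apply: apart_sym.
  have := apart_translate (lattice 0 dy) (apart_next_row uj ui (dy := - dy) ltac:(lia)).
  by rewrite translateD /= mulr0z add0r rmorphN /= mulNr addrN; case: (place i) => [[? ?] ?];
    rewrite /translate /= !add0r.
- by move=> _; exact: apart_next_row.
rewrite !orbF => ne; have := apart_place ui uj ne.
by rewrite /translate /lattice /= mul0r !add0r; case: (place j) => [[? ?] ?].
Qed.

Lemma wire_top k : (k < K)%N -> wire k 0 (top_row k).
Proof. by move=> kK; apply: WireUp => //; rewrite turn_top /=. Qed.

Lemma touch_cell_up k c r : touch (cell k c r) (cell k c r.+1).
Proof. by apply: (touch_top Qs); rewrite ?cell_size //= meshS addrA. Qed.

Lemma touch_cell_left k c r : touch (cell k c.+1 r) (cell k c r).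
Proof. by apply: (touch_right Qs); rewrite ?cell_size //= meshS opprD addrA addrNK. Qed.

(** Tip to tip: the top tip of the foot is the right tip of the cell. *)
Lemma touch_foot_cell k : touch (foot k) (cell k 1 (L k)).
Proof.
exists 0, 1, 1, 0; split; [exact: corner_top|exact: corner_right| |].
  by rewrite /= mulr0 addr0 mulr1 mul1r subrK.
by rewrite /= mulr0 addr0 mulr1 subrK.
Qed.

Lemma touch_foot_hub k : touch (foot k) hub.
Proof.
exists 0, 1, (offset (M k)), (level (M k) (L k)); split; first exact: corner_top.
- have := level_gt0 k; have := level_lt_foot k; have := off0 k; have := small_foot k.
  by move=> *; apply: (corner_down Qs (corner_half Qs)); lra.
- by rewrite /= mulr0 addr0 add0r mul1r.
- by rewrite /= mulr1 subrK add0r mul1r.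
Qed.

Lemma touch_top_foot k : (k < K)%N ->
  touch (cell k 0 (top_row k)) (translate (lattice 0 1) (foot k)).
Proof.
move=> kK; apply: (touch_top Qs); first exact: foot_size0.
  by rewrite /= mul0r subr0 mulr0z add0r.
by have := top_mesh kK; rewrite /= ?mulr1z; lra.
Qed.

(* Position along the wire, counted from the foot. *)
Definition cell_rank k c r : nat :=
  if (r < turn k)%N then (c + r)%N
  else if r == turn k then (2 * M k + turn k + 1 - c)%N else (2 * M k + 1 + r)%N.

(** On the staircase, step down if the cell below is clear of the neighbouring hub, otherwise to the
    right; only the start of the wire allows neither. On the horizontal run step left, and on
    vertical parts step down. *)
Lemma wire_pred k c r : (k < K)%N -> wire k c r -> (c = 1%N /\ r = L k) \/
  exists c' r', [/\ wire k c' r', touch (cell k c' r') (cell k c r) &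
    (cell_rank k c' r' < cell_rank k c r)%N].
Proof.
move=> kK w; have [cM nu /andP[Lr rT] side] := wire_facts kK w.
have Mk := M0 k; have [_ nL uL] := trackML k.
have tM : (2 * (2 * M k) <= turn k)%N by rewrite /turn leq_mul2r; lia.
have [rH|rH|rH] := ltngtP r (turn k).
- case: w => [/andP[c0 _] _ _ cu|rE _|_ /andP[h _]]; last 2 first.
  + by rewrite rE ltnn in rH.
  + by rewrite leqNgt rH in h.
  have r0 : (0 < r)%N by apply: leq_trans Lr; case/andP: (track_L Qs q0 (trackML k)).
  have c2M : (c <= 2 * M k)%N := leq_trans cM (leq_pmull (M k) (isT : 0 < 2)%N).
  have [u|nu'] := pselect (under (M k) c r.-1); last first.
    right; exists c, r.-1; split.
    + apply: WireStair => //; [by rewrite c0|by rewrite (leq_trans (leq_pred r)) // ltnW|].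
      case: (eqVneq c (M k)) cu => [->|cne] cu; [by left|right].
      case: cu => [cE|cu]; first by rewrite cE eqxx in cne.
      apply: (under_mono Qs Mk cu) => //; last by lia.
      by rewrite leq_pred.
    + by rewrite -{2}(prednK r0); exact: touch_cell_up.
    + rewrite /cell_rank rH (leq_ltn_trans (leq_pred r) rH) ltn_add2l.
      by rewrite ltn_predL.
  have [c1|c1] := eqVneq c 1%N.
    left; split=> //; subst c; apply/eqP; rewrite eqn_leq Lr andbT leqNgt.
    apply/negP => Lr'; apply: nL.
    by apply: (under_mono Qs Mk u) => //; rewrite -ltnS (prednK r0).
  have c'0 : (0 < c.-1)%N by case: (c) c0 c1 => [|[]].
  have cE : c = c.-1.+1 by rewrite prednK.
  right; exists c.-1, r; split.
  + apply: WireStair; [by rewrite c'0 (leq_trans (leq_pred c))| |exact: ltnW|right].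
      by move=> u'; apply: nu; apply: (under_mono Qs Mk u') => //; rewrite leq_pred.
    by rewrite -cE.
  + by apply: touch_sym; rewrite {1}cE; exact: touch_cell_left.
  + by rewrite /cell_rank rH ltn_add2r {2}cE.
- case: w => [/andP[c0 _] _ h _|rE _|cE /andP[_ h]].
  + by rewrite leqNgt rH in h.
  + by rewrite rE ltnn in rH.
  right; exists c, r.-1; rewrite cE.
  have r0 : (0 < r)%N by apply: leq_ltn_trans rH.
  have Hr : (turn k <= r.-1)%N by rewrite -ltnS (prednK r0).
  split.
  + by apply: WireUp => //; apply/andP; split => //; exact: leq_trans (leq_pred r) rT.
  + by rewrite -{2}(prednK r0); exact: touch_cell_up.
  + rewrite /cell_rank; move: (turn k) (M k) Hr rH r0 => t m Hr rH r0.
    by case: (ltngtP r.-1 t) => ?; case: (ltngtP r t) => ?; lia.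
right; have [cE|cne] := eqVneq c (M k).
  have H0 : (0 < turn k)%N by apply: leq_trans tM; rewrite !muln_gt0.
  exists c, r.-1; split.
  + rewrite cE rH; apply: WireStair; [by rewrite leqnn andbT| |exact: leq_pred|by left].
    apply: (not_under_high Qs Mk); move: tM Mk; clear; lia.
  + by rewrite -{2}(prednK (n := r)) ?rH //; exact: touch_cell_up.
  + rewrite /cell_rank rH ltnn eqxx ltn_predL H0; move: cM Mk H0; clear; lia.
exists c.+1, r; split.
- by apply: WireRun => //; rewrite ltn_neqAle cne.
- exact: touch_cell_left.
- by rewrite /cell_rank rH ltnn eqxx; move: cM; clear; lia.
Qed.
End Gadget.

(* The crossings at one contact point: [lab] tells the wire to which a copy
   belongs. Translates by dx to the right and dy rows up do not disturb one another. *)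
Record gadget (R : realType) (Q : R -> R -> Prop) (q K D : nat) (I : finType)
    (lab : I -> 'I_K) (pl : I -> R * R * R) (low : 'I_K -> I) : Prop := Gadget {
  gadget_size : forall i, 0 < (pl i).2;
  gadget_right : forall i, (pl i).1.1 + (pl i).2 <= 1;
  gadget_low_lab : forall k, lab (low k) = k;
  gadget_low_hub : forall k, touch Q (pl (low k)) (hub R);
  gadget_top : forall k, exists2 i, lab i = k &
    touch Q (pl i) (translate (0, D%:R) (pl (low k)));
  gadget_connect : forall i,
    connect [rel i j | (lab i == lab j) && `[< touch Q (pl i) (pl j) >]]
      (low (lab i)) i;
  gadget_apart : forall i j (dx dy : int), [|| i != j, dx != 0 | dy != 0] ->
    apart Q q (pl i) (translate (dx%:~R, dy%:~R * D%:R) (pl j));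
  gadget_apart_hub : forall i (dx dy : int),
    apart Q q (pl i) (translate (dx%:~R, dy%:~R * D%:R) (hub R)) }.

Lemma exists_gadget (R : realType) (Q : R -> R -> Prop) (q K : nat) :
  corner_shape Q -> (1 < q)%N ->
  exists (D : nat) (I : finType) (lab : I -> 'I_K) (pl : I -> R * R * R)
    (low : 'I_K -> I), (1 < D)%N /\ gadget Q q D lab pl low.
Proof.
move=> Qs q2; have q0 : (0 < q)%N := ltnW q2.
have [M [L [tML small_foot small_mesh nested]]] := exists_tracks Qs q0.
have wf := wire_facts Qs q2 tML small_foot.
pose B := (\max_(k < K) (M k + top_row q K M L k)).+1.
have inB (k : 'I_K) c r : wire Q q K M L k c r -> (c < B)%N /\ (r < B)%N.
  move=> /(wf _ _ _ _ (ltn_ord k))[cM _ /andP[_ rT] _].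
  have h : (M k + top_row q K M L k < B)%N by rewrite ltnS; exact: leq_bigmax.
  by split; apply: leq_ltn_trans h; [apply: leq_trans cM _; exact: leq_addr|
    apply: leq_trans rT _; exact: leq_addl].
pose P (i : slot K B) := `[< used Q q M L i >].
pose I : finType := {i : slot K B | P i}.
pose lab (i : I) := (val i).1; pose pl (i : I) := place R q M L (val i).
have uI (i : I) : used Q q M L (val i) by apply/asboolP/(valP i).
have Pfoot (k : 'I_K) : P (k, None) by apply/asboolP.
pose low k : I := exist _ (k, None) (Pfoot k).
have wireI (k : 'I_K) c r : wire Q q K M L k c r ->
    exists2 i : I, lab i = k & exists c' r' : 'I_B,
      [/\ val i = (k, Some (c', r')), c' = c :> nat & r' = r :> nat].
  move=> w; have [cB rB] := inB _ _ _ w.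
  have Pi : P (k, Some (Ordinal cB, Ordinal rB)) by apply/asboolP.
  by exists (exist (fun x => P x) _ Pi) => //; exists (Ordinal cB), (Ordinal rB).
exists (row_height K), I, lab, pl, low; split.
  by rewrite /row_height addn4.
split.
- by move=> i; exact: (place_size q2 tML).
- move=> i; have [_ h _ _] := place_box Qs q2 tML small_foot small_mesh (uI i).
  by apply: le_trans h _; lra.
- by [].
- by move=> k; exact: (touch_foot_hub Qs q2 tML small_foot).
- move=> k; have [i ik [c [r [iE cE rE]]]] := wireI k _ _ (wire_top q2 tML small_foot (ltn_ord k)).
  exists i => //; have := touch_top_foot Qs q2 tML small_foot (ltn_ord k).
  by rewrite /pl iE /= /place /= cE rE /lattice /= mulr0z mul1r.
- pose rk (i : I) := if (val i).2 is Some cr then (cell_rank M (val i).1 cr.1 cr.2).+1 else 0%N.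
  (* Induction on the position along the wire, where the foot has rank 0 and hence cells start at
     1. *)
  move=> i; have [n] := ubnP (rk i); elim: n i => // n IH [[k [[c r]|]] Pi]; last first.
    move=> _; rewrite (_ : exist (fun x => P x) _ Pi = low k) ?connect0 //.
    exact: val_inj.
  rewrite /rk /= ltnS => rn.
  have w : wire Q q K M L k c r := uI (exist (fun x => P x) _ Pi).
  have [[cE rE]|[c' [r' [w' t' lt']]]] := wire_pred Qs q2 tML small_foot (ltn_ord k) w.
    apply: connect1; rewrite /= eqxx /=; apply/asboolP.
    have := touch_foot_cell q Qs M L k.
    by rewrite /pl /= /place /= cE rE.
  have [i' ik' [c1 [r1 [iE cE rE]]]] := wireI k _ _ w'.
  apply: (connect_trans (y := i')).
    have := IH i'; rewrite ik' /=; apply; rewrite /rk iE /= cE rE.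
    exact: leq_ltn_trans lt' rn.
  apply: connect1; rewrite /= ik' eqxx /=; apply/asboolP.
  by rewrite /pl iE /= /place /= cE rE.
- move=> i j dx dy ij; apply: (apart_lattice Qs q2 tML small_foot small_mesh nested) => //.
- by move=> i dx dy; exact: (apart_hub Qs q2 tML small_foot small_mesh).
Qed.

(** * The family of copies *)

Section Assembly.
Variables (R : realType) (Q : R -> R -> Prop) (q K D : nat) (I : finType).
Variables (lab : I -> 'I_K) (pl : I -> R * R * R) (low : 'I_K -> I).
Hypotheses (Qs : corner_shape Q) (q0 : (0 < q)%N) (D1 : (1 < D)%N)
  (gad : gadget Q q D lab pl low).
Variables (a n : nat).

(** [None] is the huge copy. In [Some (i, j, o)], the column [i] is counted from right to left and
    [j] is the row; [o] is the hub if [None], and otherwise a piece of its gadget. *)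
Definition vert : finType := option ('I_a.+1 * 'I_n * option I)%type.

Definition site (i j : nat) : R * R := (- i%:R, j%:R * D%:R).

(** The left side of the huge copy runs along the abscissa 1, where the hubs of column 0 end, from
    height -1 to n D + 1. *)
Definition locate (v : vert) : R * R * R :=
  if v is Some (i, j, o) then
    translate (site i j) (if o is Some e then pl e else hub R)
  else (1, -1, n%:R * D%:R + 2).

Lemma locate_size v : 0 < (locate v).2.
Proof.
case: v => [[[i j] [e|]]|] /=; [exact: (gadget_size gad)|exact: ltr01|].
by rewrite ltr_wpDl // mulr_ge0.
Qed.

Lemma locate_right v : v != None -> (locate v).1.1 + (locate v).2 <= 1.
Proof.
case: v => [[[i j] o]|] //= _; have i0 : 0 <= i%:R :> R by [].
by case: o => [e|] /=; [have := gadget_right gad e|]; lra.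
Qed.

Lemma translate_site i j i' j' e : translate (site i' j') e =
  translate (site i j) (translate ((i%:Z - i'%:Z)%:~R, (j'%:Z - j%:Z)%:~R * D%:R) e).
Proof.
rewrite translateD /site /= !intrB -!pmulrn; congr translate; congr pair; ring.
Qed.

Lemma locate_apart u v : u != v -> apart Q q (locate u) (locate v).
Proof.
move=> uv; have su := locate_size u; have sv := locate_size v.
have [uN|uN] := eqVneq u None.
  subst u; apply: apart_sym; apply: (apart_left0 Qs q0) => //.
  by apply: locate_right; rewrite eq_sym.
have [vN|vN] := eqVneq v None.
  by subst v; apply: (apart_left0 Qs q0) => //; exact: locate_right.
case: u v uv uN vN {su sv} => [[[i j] o]|] // [[[i' j'] o']|] // uv _ _.
case: o o' uv => [e|] [e'|] uv /=.
- rewrite (translate_site i j i' j'); apply: apart_translate; apply: (gadget_apart gad).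
  apply: contraNT uv; rewrite !negb_or !negbK => /and3P[/eqP-> i0 j0].
  apply/eqP; congr (Some (_, _, _)); apply: val_inj => /=; lia.
- by rewrite (translate_site i j i' j'); apply: apart_translate; exact: (gadget_apart_hub gad).
- apply: apart_sym; rewrite (translate_site i' j' i j); apply: apart_translate.
  exact: (gadget_apart_hub gad).
have hs (k l k' l' : nat) : (k < k')%N \/ (l < l')%N ->
    apart Q q (translate (site k l) (hub R)) (translate (site k' l') (hub R)).
  move=> [kk|ll].
    apply: apart_sym; apply: (apart_left0 Qs q0); rewrite /= ?ltr01 // !addr0.
    by have : k%:R + 1 <= k'%:R :> R; [rewrite natr1 ler_nat|lra].
  apply: (apart_below0 Qs q0); rewrite /= ?ltr01 // !addr0.
  have : l.+1%:R * D%:R <= l'%:R * D%:R :> R by rewrite ler_wpM2r // ler_nat.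
  have : 1 <= D%:R :> R by rewrite ler1n ltnW.
  by rewrite -natr1 mulrDl mul1r; lra.
have [ii|ii|ii] := ltngtP i i'; [by apply: hs; left|by apply: apart_sym; apply: hs; left|].
have [jj|jj|jj] := ltngtP j j'; [by apply: hs; right|by apply: apart_sym; apply: hs; right|].
by case/eqP: uv; congr (Some (_, _, _)); exact: val_inj.
Qed.

Definition assembly_graph : graph := touch_graph Q locate.

Lemma edge_touch (u v : vert) : touch Q (locate u) (locate v) ->
  u = v \/ @edge assembly_graph u v.
Proof.
move=> t; have [->|uv] := eqVneq u v; [by left|right].
by rewrite /edge /= /touch_rel uv; apply/asboolP.
Qed.

Definition chain (j : 'I_n) : {set assembly_graph} :=
  [set v : vert | if v is Some (_, j', None) then j' == j else false].

Definition strand (ik : 'I_a.+1 * 'I_K) : {set assembly_graph} :=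
  [set v : vert | if v is Some (i, _, Some e) then (i, lab e) == ik else false].

Lemma hub_step (i i' : 'I_a.+1) (j : 'I_n) : i' = i.+1 :> nat ->
  touch Q (locate (Some (i', j, None))) (locate (Some (i, j, None))).
Proof.
move=> ii; apply: (touch_right Qs); rewrite /= ?ltr01 // !addr0 ii -natr1; lra.
Qed.

Lemma hub_end (j : 'I_n) : touch Q (locate None) (locate (Some (ord0, j, None))).
Proof.
have jn : j%:R * D%:R <= n%:R * D%:R :> R by rewrite ler_wpM2r // ler_nat ltnW.
have j0 : 0 <= j%:R * D%:R :> R by rewrite mulr_ge0.
have s0 : 0 < n%:R * D%:R + 2 :> R by rewrite ltr_wpDl // mulr_ge0.
(* The contact is the right tip of the hub, at height j D, that is, j D + 1 above the lower corner
   of the huge copy. *)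
exists 0, ((j%:R * D%:R + 1) / (n%:R * D%:R + 2)), 1, 0; split.
- apply: (corner_down Qs (corner_top Qs)); first by rewrite lexx.
  by rewrite divr_ge0 ?(ltW s0) ?addr_ge0 //= ler_pdivrMr // mul1r; lra.
- exact: corner_right.
- by rewrite /=; lra.
- by rewrite /= mulrC divfK ?gt_eqF //; lra.
Qed.

Lemma hub_low i j k :
  touch Q (locate (Some (i, j, Some (low k)))) (locate (Some (i, j, None))).
Proof. by apply: touch_translate; exact: (gadget_low_hub gad). Qed.

Lemma rel_in_touch (A : {set assembly_graph}) (u v : vert) : u \in A -> v \in A ->
  touch Q (locate u) (locate v) -> connect (rel_in (@edge assembly_graph) A) u v.
Proof.
move=> uA vA /edge_touch[->|uv]; first exact: connect0.
by apply: connect1; apply/and3P; split.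
Qed.

Lemma chain_connected j : connected_in (@edge assembly_graph) (chain j).
Proof.
have inC i : (Some (i, j, None) : vert) \in chain j by rewrite inE.
apply: (@connected_in_root _ _ _ (Some (ord0, j, None))); first exact: (@edge_sym assembly_graph).
case=> [[[[i ia] j'] [e|]]|]; rewrite inE // => /eqP->.
elim: i ia => [|i IH] ia; first by rewrite (_ : Ordinal ia = ord0) ?connect0 //; exact: val_inj.
apply: connect_trans (IH (ltnW ia)) _; apply: rel_in_touch => //.
by apply: touch_sym; exact: hub_step.
Qed.

(** Within a row every piece is linked to the foot, and the top cell touches the foot of the next
    row. *)
Lemma strand_connected ik : connected_in (@edge assembly_graph) (strand ik).
Proof.
case: ik => i k; case: (posnP n) => n0.
  case=> [[[i' j] o]|]; last by rewrite inE.
  by case/eqP: (lt0n_neq0 (leq_ltn_trans (leq0n j) (ltn_ord j))).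
have inS j e : lab e = k -> (Some (i, j, Some e) : vert) \in strand (i, k).
  by move=> ek; rewrite inE ek.
have lk := gadget_low_lab gad k.
have row j e : lab e = k -> connect (rel_in (@edge assembly_graph) (strand (i, k)))
    (Some (i, j, Some (low k))) (Some (i, j, Some e)).
  move=> ek; have := gadget_connect gad e; rewrite ek.
  move=> /connectP[p pp ->]; elim: p (low k) lk pp => [|x p IH] y yk /=; first by rewrite connect0.
  move=> /andP[/andP[/eqP yx /asboolP t] pp].
  apply: connect_trans (IH x _ pp); last by rewrite -yx.
  apply: rel_in_touch; [exact: inS|by apply: inS; rewrite -yx|].
  exact: touch_translate.
apply: (@connected_in_root _ _ _ (Some (i, Ordinal n0, Some (low k)))).
  exact: (@edge_sym assembly_graph).
case=> [[[i' [j jn]] [e|]]|]; rewrite inE // => /eqP[-> ek].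
apply: connect_trans (row _ _ ek); elim: j jn => [|j IH] jn.
  by rewrite (_ : Ordinal jn = Ordinal n0) ?connect0 //; exact: val_inj.
apply: connect_trans (IH (ltnW jn)) _; have [t tk tt] := gadget_top gad k.
apply: connect_trans (row _ _ tk) _; apply: rel_in_touch; [exact: inS|exact: inS|].
have := touch_translate (site i j) tt; rewrite translateD /site /= addr0.
by rewrite /locate /site /= -(natr1 j) mulrDl mul1r.
Qed.

(** From the huge copy go along the hubs of the row, then to a foot, then inside one gadget; the
    bound is independent of the number of rows. *)
Lemma assembly_reach v : (exists j, v \in chain j) \/ (exists ik, v \in strand ik) ->
  reach (a.+2 + #|I|) (None : assembly_graph) v.
Proof.
move=> vU.
have hubs (i : 'I_a.+1) j : reach i.+1 (None : assembly_graph) (Some (i, j, None)).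
  case: i => i ia /=; elim: i ia => [|i IH] ia.
    rewrite (_ : Ordinal ia = ord0); last exact: val_inj.
    apply: (@reach_step assembly_graph 0 None None); first by exists [::].
    exact/edge_touch/hub_end.
  apply: reach_step (IH (ltnW ia)) _; apply/edge_touch.
  by apply: touch_sym; exact: hub_step.
case: v vU => [[[i j] [e|]]|] vU; last 2 first.
- apply: reach_leq (hubs i j); apply: leq_trans (ltn_ord i) _.
  exact: leq_trans (leqnSn _) (leq_addr _ _).
- by case: vU => -[?]; rewrite inE.
apply: (@reach_path assembly_graph I [rel x y | (lab x == lab y) && `[< touch Q (pl x) (pl y) >]]
  (fun x => Some (i, j, Some x)) _ _ (low (lab e))); last exact: (gadget_connect gad).
  by move=> x y /andP[_ /asboolP t]; apply: edge_touch; exact: touch_translate.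
apply: (@reach_leq _ i.+2); first by rewrite ltnS; exact: ltn_ord.
by apply: reach_step (hubs i j) _; apply/edge_touch/touch_sym/hub_low.
Qed.

Lemma assembly_bound (H : graph) m t : treewidth_at_most t H ->
  subgraph assembly_graph (strong_product H (path_graph m)) ->
  (n <= t.+1 * (a.+2 + #|I|).*2.+1)%N \/ (a.+1 * K <= t.+1 * (a.+2 + #|I|).*2.+1)%N.
Proof.
move=> tw sub.
have := @product_bramble assembly_graph H m t (a.+2 + #|I|) 'I_n
  ('I_a.+1 * 'I_K)%type chain strand None tw sub.
rewrite card_prod !card_ord; apply.
- exact: chain_connected.
- exact: strand_connected.
- by move=> j j' [[[i k] [e|]]|]; rewrite !inE // => /eqP-> /eqP.
- by move=> x y [[[i k] [e|]]|]; rewrite !inE // => /eqP-> /eqP.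
- move=> j [i k]; exists (Some (i, j, None)), (Some (i, j, Some (low k))).
  rewrite !inE (gadget_low_lab gad) !eqxx; split => //.
  exact/edge_touch/touch_sym/hub_low.
- exact: assembly_reach.
Qed.
End Assembly.

(* l(S) is the segment [c, p], b(S) is the segment [c, q] *)
Theorem lemma11 (R : realType) (S : set (R * R)%type) (c p q : (R * R)%type)
    (shapeS : plane_shape S) (convexS : convex_set S)
    (side_l : side S c p) (side_b : side S c q)
    (orth_lb : orthogonal_vec (p - c) (q - c))
    (S_sub_rect : S `<=` spanned_rectangle c p q)
    (not_parallel : forall x y : (R * R)%type, side S x y ->
      seg x y <> seg c p -> seg x y <> seg c q ->
      ~ parallel_vec (y - x) (p - c) /\ ~ parallel_vec (y - x) (q - c))
    (alpha : R) (alpha_range : 0 <= alpha < 1) :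
  ~ admits_product_structure (free_homothets_class S alpha).
Proof.
move=> [t tP]; case/andP: alpha_range => alpha0 alpha1.
pose Q s u := S (frame c p q (s, u)).
have Qs : corner_shape Q by exact: S_corner_shape.
have [N N3 alphaN] : exists2 N : nat, (3 < N)%N & alpha <= (1 - 3 / N%:R) ^+ 2.
  (* The bound follows from (1 - 3/N)^2 >= 1 - 6/N. *)
  pose b := Num.bound (6 / (1 - alpha)); exists (b + 4)%N; first by rewrite addn4.
  have b0 : 6 / (1 - alpha) < (b + 4)%:R.
    apply: lt_le_trans (archi_boundP _) _; last by rewrite ler_nat leq_addr.
    by rewrite divr_ge0 //; lra.
  have N0 : 0 < (b + 4)%:R :> R by rewrite ltr0n addn4.
  have h : 6 / (b + 4)%:R < 1 - alpha.
    by rewrite ltr_pdivrMr // mulrC -ltr_pdivrMr //; lra.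
  have := sqr_ge0 (3 / (b + 4)%:R : R); lra.
have [D [I [lab [pl [low [D1 gad]]]]]] :=
  exists_gadget (q := N) (3 * t.+1) Qs (ltn_trans (isT : 1 < 3)%N N3).
have N0 : (0 < N)%N by apply: leq_trans N3.
(* The gadget does not depend on [a]. Both alternatives of [assembly_bound] bound the same number n
   = 3 (t + 1) (a + 1), and a > 2 #|I| + 2 gives 2 (a + 2 + #|I|) + 1 < 3 (a + 1). *)
pose a := (2 * #|I| + 6)%N; pose n := (a.+1 * (3 * t.+1))%N.
have [H [m [tw sub]]] : exists (H : graph) (m : nat), treewidth_at_most t H /\
    subgraph (assembly_graph Q D pl a n) (strong_product H (path_graph m)).
  apply: tP; apply: (@free_touch_graph R S c p q Q _ _ _ Qs alpha N) => //.
  - by case: shapeS.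
  - exact: (frame_inj side_l side_b).
  - exact: (S_frameE S_sub_rect).
  - exact: (locate_size gad).
  - exact: (locate_apart Qs N0 D1 gad).
have := assembly_bound Qs gad tw sub.
suff : (t.+1 * (a.+2 + #|I|).*2.+1 < n)%N by move=> h; case=> /leq_trans/(_ h); rewrite ltnn.
have -> : n = (t.+1 * (3 * a.+1))%N by rewrite /n mulnCA (mulnC a.+1) mulnCA.
by rewrite ltn_pmul2l // /a; lia.
Qed.
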